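(* Consider the parallel Schwarz method with Robin transmission conditions for the two-dimensional Helmholtz wave-guide problem described in the context. Suppose $\alpha=ik$ (the case of classical impedance conditions) and that $\sigma=\sigma_0k$ for some constant $\sigma_0>0$. Consider a $k$-dependent domain decomposition given by $L=L_0k^{-1}$ and $\delta=\delta_0k^{-1}$, with constants $L_0,\delta_0>0$; that is, the subdomain size and overlap shrink inversely proportional to the wave number. Then the convergence factor $R_{2d}^{\mathrm H}$ can be bounded above by a $k$-independent value and this bound becomes tight as $k\to\infty$. As such, the convergence of the corresponding Schwarz method is ultimately independent of the wave number $k$ as it increases. Under the additional assumption for convergence that between them $\sigma_0$, $L_0$ and $\delta_0$ are sufficiently large (which in particular is satisfied when $\sigma_0\ge1$, for all $L_0>0$ and $\delta_0>0$), the approach will ultimately be $k$-robust and independent of the number of subdomains.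
   Context: Domain $\Omega=(a_1,b_N)\times(0,\hat L)$, with $\hat L>0$, decomposed into $N$ overlapping subdomains $\Omega_j=(a_j,b_j)\times(0,\hat L)$, $j=1,\dots,N$, with $b_j-a_j=L+2\delta$, $b_{j-1}-a_j=2\delta$, $a_{j+1}-a_j=b_{j+1}-b_j=L$. The wave number is $k>0$. The parallel Schwarz method computes iterates $u_j^n$ by solving $(ik\sigma-k^2)u_j^n-(\partial_{xx}+\partial_{yy})u_j^n=f$ in $\Omega_j$, with $\mathcal{B}_lu_j^n=\mathcal{B}_lu_{j-1}^{n-1}$ at $x=a_j$, $\mathcal{B}_ru_j^n=\mathcal{B}_ru_{j+1}^{n-1}$ at $x=b_j$ (with the prescribed boundary data at the two ends $x=a_1$, $x=b_N$), and $u_j^n=0$ for $y\in\{0,\hat L\}$, where $\mathcal{B}_l=-\partial_x+\alpha$, $\mathcal{B}_r=\partial_x+\alpha$. Expanding the local errors in a sine series in $y$ with Fourier numbers $\tilde k=\frac{m\pi}{\hat L}$, $m\in\{1,2,\dots\}$, each mode evolves independently, its Robin interface data being multiplied at each iteration by the matrix $\mathcal{T}_{1d}^{\mathrm H}(\tilde k)$. Here $\mathcal{T}_{1d}^{\mathrm H}(\tilde k)\in\mathbb{C}^{2(N-1)\times2(N-1)}$ is the block tridiagonal block Toeplitz matrix with $2\times2$ blocks: diagonal blocks $A_0=\begin{bmatrix}0&b\\ b&0\end{bmatrix}$, first superdiagonal blocks $A_1=\begin{bmatrix}a&0\\0&0\end{bmatrix}$, first subdiagonal blocks $A_{-1}=\begin{bmatrix}0&0\\0&a\end{bmatrix}$,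 where $$a=\frac{(\zeta+\alpha)^2e^{2\zeta\delta}-(\zeta-\alpha)^2e^{-2\zeta\delta}}{(\zeta+\alpha)^2e^{\zeta(2\delta+L)}-(\zeta-\alpha)^2e^{-\zeta(2\delta+L)}},\qquad b=-\frac{(\zeta^2-\alpha^2)(e^{\zeta L}-e^{-\zeta L})}{(\zeta+\alpha)^2e^{\zeta(2\delta+L)}-(\zeta-\alpha)^2e^{-\zeta(2\delta+L)}},$$ with $\alpha=ik$ and $\zeta=\zeta(\tilde k)=\sqrt{ik\sigma+\tilde k^2-k^2}$ (principal square root). With $\rho$ the spectral radius, $R_{1d}^{\mathrm H}(\tilde k):=\lim_{N\to\infty}\rho(\mathcal{T}_{1d}^{\mathrm H}(\tilde k))$ and $R_{2d}^{\mathrm H}:=\sup_{\tilde k}R_{1d}^{\mathrm H}(\tilde k)$, the supremum being over all $\tilde k=\frac{m\pi}{\hat L}$, $m\ge1$. ''$k$-robust'' means that the convergence of the method is independent of the wave number $k$. *)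

(* Defs.v *)
From HB Require Import structures.
From mathcomp Require Import all_boot all_order all_algebra.
From mathcomp Require Import all_classical all_reals all_analysis.
From mathcomp.real_closed Require Import complex.

Set Implicit Arguments.
Unset Strict Implicit.
Unset Printing Implicit Defensive.

Import Order.TTheory GRing.Theory Num.Theory.
Import numFieldNormedType.Exports.

Local Open Scope classical_set_scope.
Local Open Scope ring_scope.
Local Open Scope complex_scope.

Definition cexp (R : realType) (z : R[i]) : R[i] :=
  (expR (complex.Re z) * cos (complex.Im z))
  +i* (expR (complex.Re z) * sin (complex.Im z)).

(* The set of eigenvalues is finite, and nonempty as soon as 0 < n, so the
   supremum is a maximum; it is 0 for the empty matrix. *)
Definition spectral_radius (R : realType) (n : nat) (A : 'M[R[i]]_n) : R :=
  sup [set ComplexField.Normc.normc l | l in [set l | eigenvalue A l]].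

Definition mx22 (K : Type) (x00 x01 x10 x11 : K) : 'M[K]_2 :=
  \matrix_(i, j) if i == ord0 then (if j == ord0 then x00 else x01)
                 else (if j == ord0 then x10 else x11).

Definition block_tridiag_toeplitz (K : nzRingType) (p n : nat)
    (Am1 A0 A1 : 'M[K]_p) : 'M[K]_(\sum_(i < n) p) :=
  \mxblock_(i < n, j < n)
    if val j == val i then A0
    else if val j == (val i).+1 then A1
    else if val i == (val j).+1 then Am1
    else 0.

Section Schwarz.
Variable R : realType.

(* sqrtc is the principal square root. *)
Definition zeta (k sigma ktilde : R) : R[i] :=
  sqrtc ((ktilde ^+ 2 - k ^+ 2) +i* (k * sigma)).

Section Coefficients.
Variables (alpha z : R[i]) (L delta : R).

Definition schwarz_den : R[i] :=
  (z + alpha) ^+ 2 * cexp (z * (2 * delta + L)%:C)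
  - (z - alpha) ^+ 2 * cexp (- (z * (2 * delta + L)%:C)).

Definition schwarz_a : R[i] :=
  ((z + alpha) ^+ 2 * cexp (2 * z * delta%:C)
   - (z - alpha) ^+ 2 * cexp (- (2 * z * delta%:C))) / schwarz_den.

Definition schwarz_b : R[i] :=
  - (((z ^+ 2 - alpha ^+ 2) * (cexp (z * L%:C) - cexp (- (z * L%:C))))
     / schwarz_den).
End Coefficients.

(* N is the number of subdomains, so that there are N - 1 blocks. *)
Definition T1d (alpha : R[i]) (k sigma L delta ktilde : R) (N : nat) :=
  let a := schwarz_a alpha (zeta k sigma ktilde) L delta in
  let b := schwarz_b alpha (zeta k sigma ktilde) L delta in
  block_tridiag_toeplitz N.-1
    (mx22 0 0 0 a) (mx22 0 b b 0) (mx22 a 0 0 0).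

Definition R1d (alpha : R[i]) (k sigma L delta ktilde : R) : R :=
  limn (fun N => spectral_radius (T1d alpha k sigma L delta ktilde N)).

Definition fourier_number (Lhat : R) (m : nat) : R := m%:R * pi / Lhat.

(* The supremum is taken in \bar R, so that it is meaningful even before the
   family is known to be bounded. *)
Definition R2d (alpha : R[i]) (k sigma L delta Lhat : R) : \bar R :=
  ereal_sup [set (R1d alpha k sigma L delta (fourier_number Lhat m))%:E
            | m in [set m : nat | (0 < m)%N]].

(* P expresses that "between them" three positive parameters are sufficiently
   large: it is preserved when parameters increase, and whatever the values of
   two of them it is reached by taking the third one large enough. *)
Definition jointly_large (P : R -> R -> R -> Prop) : Prop :=
  [/\ forall s L d s' L' d', 0 < s -> 0 < L -> 0 < d ->
        s <= s' -> L <= L' -> d <= d' -> P s L d -> P s' L' d',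
      forall L d, 0 < L -> 0 < d -> exists2 s, 0 < s & P s L d,
      forall s d, 0 < s -> 0 < d -> exists2 L, 0 < L & P s L d
    & forall s L, 0 < s -> 0 < L -> exists2 d, 0 < d & P s L d].
End Schwarz.

(* Main.v *)
Require Import Defs.
From mathcomp Require Import all_boot all_order all_algebra.
From mathcomp Require Import all_classical all_reals all_analysis.
From mathcomp.real_closed Require Import complex.
From mathcomp Require Import ring lra zify.

Set Implicit Arguments.
Unset Strict Implicit.
Unset Printing Implicit Defensive.

Import Order.TTheory GRing.Theory Num.Theory.
Import numFieldNormedType.Exports.

Local Open Scope classical_set_scope.
Local Open Scope ring_scope.
Local Open Scope complex_scope.

(** Dividing lengths by 1/k, i.e. writing k * z for zeta with
    z = sqrt(s^2 - 1 + i sigma0) and s = ktilde / k, removes k from the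
    coefficients a and b.  Each mode is thus governed by one k-independent
    curve s |-> a(s), b(s) on ]0, +oo[, sampled at s = m pi / (Lhat k); only the
    sampling depends on k, and it becomes dense as k grows.  The bound Rbar is
    the supremum over all s > 0 of r(s) = max(|a + b|, |a - b|).

    For a fixed mode, r is the limit of the spectral radii as the number of
    subdomains grows.
    - [eigenvalue_toeplitz_le]: no eigenvalue exceeds r.  Up to swapping the two
      unknowns of each block the matrix is b + a H with H real symmetric of
      norm at most 1; in coordinates this is the parallelogram identity.
    - [eigenvalue_near_double_point]: eigenvalues come arbitrarily close to the
      radius r.  They are given by 1 / l^2 being a root of polynomials Q_n
      defined by a three-term recurrence.  Say |a + b| >= |a - b|; at
      t = (a + b)^-2 the characteristic equation of this recurrence has a
      double root, so that Q_n(t) and Q_n'(t) are explicit and Q_n'(t) / Q_n(t)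
      grows at least like n^2.  If all roots of Q_n, at most n in number, stayed
      away from t, this logarithmic derivative would only be O(n).

    With z = x + i y, e = exp(- z L0) and h = exp(- 2 z delta0) (z - i) / (z + i)
    one finds a + b = (e - h) / (1 - h e) and a - b = (e + h) / (1 + h e), both
    |e| and |h| being less than 1.  Hence r < 1 as soon as
    4 |Im e| |Im h| < (1 - |e|^2) (1 - |h|^2) ([mobius_contraction]).  When
    sigma0 >= 1 the two sines in Im e and Im h are controlled by their
    arguments, and the resulting ratios y / x and x / y cancel; otherwise the
    two exponential decays are used, Re z being bounded below uniformly in s.
    Every estimate is uniform in s, which gives Rbar < 1 and not only r < 1.

    Finally r is continuous on ]0, +oo[, so that the suprema over the sampling
    points, all at most Rbar, tend to Rbar. *)

Local Notation normc := ComplexField.Normc.normc.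
Local Notation toeplitz n a b :=
  (block_tridiag_toeplitz n (mx22 0 0 0 a) (mx22 0 b b 0) (mx22 a 0 0 0)).

(** * Action of the iteration matrix on row vectors *)

Section RowAction.
Variables (K : fieldType) (n : nat) (a b : K).

(** The first entries of the blocks are shifted by one, so that v j and p j,
    padded by p 0 = 0 and v n = 0, are mixed together by the matrix. *)
Definition interface_row (v p : nat -> K) : 'rV[K]_(\sum_(i < n) 2) :=
  \mxrow_(j < n) \row_(c < 2) (if c == ord0 then p j.+1 else v j).

Lemma eq_interface_row (v p v' p' : nat -> K) :
  (forall j, (j < n)%N -> v j = v' j /\ p j.+1 = p' j.+1) <->
  interface_row v p = interface_row v' p'.
Proof.
rewrite /interface_row; split=> [e|/eq_mxrowP e j jn].
  apply: eq_mxrow => j; apply/rowP => c; rewrite !mxE.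
  by have [-> ->] := e j (ltn_ord j).
have /rowP ej := e (Ordinal jn).
by have := ej ord0; have := ej ord_max; rewrite !mxE.
Qed.

Lemma interface_rowP (w : 'rV[K]_(\sum_(i < n) 2)) :
  exists v p, [/\ p 0%N = 0, v n = 0 & w = interface_row v p].
Proof.
pose f c j := if insub j is Some i then submxrow w i ord0 c else 0.
exists (f ord_max), (fun j => if j is i.+1 then f ord0 i else 0); split=> //.
  by rewrite /f insubF // ltnn.
rewrite -[LHS]submxrowK; apply: eq_mxrow => j; apply/rowP => c.
rewrite [RHS]mxE /f valK; have [->//|c0] := eqVneq c ord0.
by congr (submxrow w j _ _); apply: val_inj; case: c c0 => [[|[|]]].
Qed.

Lemma interface_row_mul (v p : nat -> K) : p 0%N = 0 -> v n = 0 ->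
  interface_row v p *m toeplitz n a b =
  interface_row (fun j => b * p j.+1 + a * v j.+1)
                (fun j => b * v j.-1 + a * p j.-1).
Proof.
move=> p0 vn; rewrite /interface_row mul_mxrow_mxblock.
apply: eq_mxrow => j; apply/rowP => c; rewrite summxE mxE.
have sum1 (X : K) : \sum_(i < n) (if i == j then X else 0) = X.
  by rewrite -big_mkcond big_pred1_eq.
have [->|c0] := eqVneq c ord0.
  have -> : a * p j = \sum_(i < n) (if j == i.+1 :> nat then a * p j else 0).
    case: (posnP j) => [j0|j0].
      by rewrite j0 p0 mulr0 big1.
    have jn : (j.-1 < n)%N by rewrite (leq_ltn_trans (leq_pred _) (ltn_ord j)).
    rewrite -big_mkcond (big_pred1 (Ordinal jn)) // => i /=.
    by rewrite -[in RHS](inj_eq val_inj) /= -(prednK j0) eqSS eq_sym.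
  rewrite -[b * v j]sum1 -big_split; apply: eq_bigr => i _ /=.
  rewrite !mxE !big_ord_recl big_ord0 !mxE /=.
  have [e|ij] := eqVneq i j.
    rewrite e eqxx !mxE /= (ltn_eqF (ltnSn (val j))); ring.
  rewrite -(inj_eq val_inj) eq_sym in ij; rewrite (negbTE ij).
  have [ji|ji] := eqVneq (j : nat) i.+1.
    rewrite ji !mxE /=; ring.
  case: ifP => _; rewrite !mxE /=; ring.
have -> : c = ord_max by apply: val_inj; case: c c0 => [[|[|]]].
have -> : a * v j.+1 = \sum_(i < n) (if i == j.+1 :> nat then a * v j.+1 else 0).
  have [jn|nj] := ltnP j.+1 n.
    rewrite -big_mkcond (big_pred1 (Ordinal jn)) // => i /=.
  have -> : j.+1 = n by apply/eqP; rewrite eqn_leq nj ltn_ord.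
  by rewrite vn mulr0 big1 // => i _; case: ifP.
rewrite -[b * p j.+1]sum1 -big_split; apply: eq_bigr => i _ /=.
rewrite !mxE !big_ord_recl big_ord0 !mxE /=.
have [e|ij] := eqVneq i j.
  rewrite e eqxx !mxE /= (ltn_eqF (ltnSn (val j))); ring.
rewrite -(inj_eq val_inj) eq_sym in ij; rewrite (negbTE ij).
have [ji|ji] := eqVneq (j : nat) i.+1.
  rewrite ji !mxE /= (ltn_eqF (ltnW (ltnSn (val i).+1))); ring.
have [ji'|ji'] := eqVneq (i : nat) j.+1; last by rewrite !mxE /=; ring.
rewrite ji' !mxE /=; ring.
Qed.

Lemma interface_rowZ (l : K) (v p : nat -> K) :
  l *: interface_row v p = interface_row (fun j => l * v j) (fun j => l * p j).
Proof. by apply/rowP => c; rewrite !mxE; case: ifP. Qed.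

Lemma interface_row0 : interface_row (fun=> 0) (fun=> 0) = 0.
Proof.
apply/mxrowP => j; rewrite mxrowK submxrow0.
by apply/rowP => c; rewrite !mxE; case: ifP.
Qed.

End RowAction.

(** * Upper bound on the eigenvalues *)


Section NormBound.
Variables (K : numClosedFieldType) (n : nat) (a b r : K).
Hypotheses (abD : `|a + b| <= r) (abB : `|a - b| <= r).

Lemma parallelogram (x y : K) :
  `|x + y| ^+ 2 + `|x - y| ^+ 2 = 2 * (`|x| ^+ 2 + `|y| ^+ 2).
Proof. by rewrite !normCK rmorphD rmorphB; ring. Qed.

(** The 2 x 2 matrix with diagonal a and off-diagonal b is normal with
    eigenvalues a + b and a - b, hence it has norm max(|a + b|, |a - b|). *)
Lemma swap_norm_le (v p : K) :
  `|b * v + a * p| ^+ 2 + `|b * p + a * v| ^+ 2 <=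
  r ^+ 2 * (`|v| ^+ 2 + `|p| ^+ 2).
Proof.
have r0 : 0 <= r by apply: le_trans abD.
rewrite -(@ler_pM2l _ 2) // -parallelogram mulrCA -parallelogram mulrDr.
have -> : b * v + a * p + (b * p + a * v) = (a + b) * (v + p) by ring.
have -> : b * v + a * p - (b * p + a * v) = - ((a - b) * (v - p)) by ring.
rewrite normrN !normrM !exprMn.
by apply: lerD; apply: ler_wpM2r; rewrite ?exprn_ge0 // lerXn2r ?nnegrE.
Qed.

(** The matrix acts on each pair (v j, p j), 0 <= j <= n, by a 2 x 2 matrix of
    norm at most r, and then drops two coordinates. *)
Lemma eigenvalue_toeplitz_le (l : K) : eigenvalue (toeplitz n a b) l -> `|l| <= r.
Proof.
have r0 : 0 <= r by apply: le_trans abD.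
case/eigenvalueP => w; have [v [p [p0 vn ->]]] := interface_rowP w.
rewrite interface_row_mul // interface_rowZ.
move/eq_interface_row => e w0.
pose S (x y : nat -> K) := \sum_(j < n) `|y j.+1| ^+ 2 + \sum_(j < n) `|x j| ^+ 2.
have SE : \sum_(j < n.+1) (`|v j| ^+ 2 + `|p j| ^+ 2) = S v p.
  rewrite big_split /= big_ord_recr /= vn normr0 expr0n addr0.
  by rewrite [X in _ + X]big_ord_recl p0 normr0 expr0n add0r addrC.
have S0 : 0 < S v p.
  rewrite lt_neqAle addr_ge0 ?sumr_ge0 ?andbT //.
    apply: contraNneq w0 => /esym/eqP; rewrite paddr_eq0 ?sumr_ge0 //.
    rewrite !psumr_eq0 => [/andP[/allP hp /allP hv]||] //.
    rewrite -(interface_row0 K n); apply/eqP/eq_interface_row => j jn.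
    have := hp (Ordinal jn) (mem_index_enum _).
    have := hv (Ordinal jn) (mem_index_enum _).
    by rewrite !expf_eq0 !normr_eq0 /= => /eqP -> /eqP ->.
suff : `|l| ^+ 2 * S v p <= r ^+ 2 * S v p.
  by rewrite ler_pM2r // ler_sqr ?nnegrE.
rewrite -[in leRHS]SE mulr_sumr.
(* The sum over j < n.+1 restores the two dropped coordinates. *)
apply: (@le_trans _ _ (\sum_(j < n.+1)
    (`|b * v j + a * p j| ^+ 2 + `|b * p j + a * v j| ^+ 2))); last first.
  by apply: ler_sum => j _; apply: swap_norm_le.
rewrite big_split /= big_ord_recr [X in _ + X]big_ord_recl /=.
rewrite [X in _ <= _ + X]addrC addrACA -[leLHS]addr0; apply: lerD.
  rewrite mulrDr !mulr_sumr le_eqVlt; apply/orP; left; apply/eqP.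
  congr (_ + _); apply: eq_bigr => j _; have [ev ep] := e j (ltn_ord j).
    by rewrite -exprMn -normrM -ep.
  by rewrite -exprMn -normrM -ev.
by rewrite addr_ge0 // exprn_ge0.
Qed.

End NormBound.

(** * Eigenvalues as roots of a recurrent family of polynomials *)

Section LogDerivative.
Variable K : numFieldType.

(** The logarithmic derivative of a product of linear factors is the sum of the
    1 / (x - z), each of which has norm at most 1 / d. *)
Lemma norm_deriv_prod_le (s : seq K) (x d : K) : 0 <= d ->
  (forall z, z \in s -> d <= `|x - z|) ->
  d * `|(\prod_(z <- s) ('X - z%:P))^`().[x]| <=
  (size s)%:R * `|(\prod_(z <- s) ('X - z%:P)).[x]|.
Proof.
move=> d0; elim: s => [|z s IHs] far.
  by rewrite !big_nil -polyC1 derivC horner0 normr0 mulr0 mul0r.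
rewrite !big_cons derivM derivXsubC !hornerE !normrM.
have {}IHs : d * `|(\prod_(z <- s) ('X - z%:P))^`().[x]| <=
  (size s)%:R * `|(\prod_(z <- s) ('X - z%:P)).[x]|.
  by apply: IHs => y ys; apply: far; rewrite inE ys orbT.
have dz : d <= `|x - z| by apply: far; rewrite inE eqxx.
apply: (le_trans (ler_wpM2l d0 (ler_normD _ _))).
rewrite mulrDr /= -natr1 [leRHS]mulrDl mul1r [leRHS]addrC; apply: lerD.
  exact: ler_wpM2r.
rewrite normrM mulrCA [leRHS]mulrCA.
exact: ler_wpM2l.
Qed.

End LogDerivative.

Section SchwarzPoly.
Variables (K : fieldType) (a b : K).

(** The pair of Q_n and Q_(n-1), where Q_n(1 / l^2) l^(2 n) is the
    characteristic polynomial at l of the matrix with n blocks; the value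
    Q_(-1) = 1 is the one which makes the recurrence hold from n = 0. *)
Fixpoint schwarz_polys n : {poly K} * {poly K} :=
  if n is m.+1 then
    let q := schwarz_polys m in
    ((1 + (a ^+ 2 - b ^+ 2)%:P * 'X) * q.1 - (a ^+ 2)%:P * 'X * q.2, q.1)
  else (1, 1).

Definition schwarz_poly n := (schwarz_polys n).1.

Lemma size_schwarz_poly n : (size (schwarz_poly n) <= n.+1)%N.
Proof.
suff: (size (schwarz_polys n).1 <= n.+1)%N /\
      (size (schwarz_polys n).2 <= n.-1.+1)%N by case.
have sizeX (c : K) : (size (c%:P * 'X)%R <= 2)%N.
  have [->|c0] := eqVneq c 0; first by rewrite mul0r size_poly0.
  by rewrite size_Cmul // size_polyX.
elim: n => [|n [IH1 IH2]] /=; first by rewrite size_poly1.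
split=> //; apply: (leq_trans (size_polyD _ _)); rewrite size_polyN geq_max.
have size_mul (p q : {poly K}) :
    (size p <= 2)%N -> (size q <= n.+1)%N -> (size (p * q)%R <= n.+2)%N.
  by move=> sp sq; rewrite (leq_trans (size_polyMleq _ _)) //; lia.
rewrite !size_mul ?sizeX // ?(leq_trans IH2) //; first by rewrite ltnS leq_pred.
by rewrite (leq_trans (size_polyD _ _)) // geq_max size_poly1 sizeX.
Qed.

Lemma schwarz_poly_at0 n : (schwarz_poly n).[0] = 1.
Proof.
suff: (schwarz_polys n).1.[0] = 1 /\ (schwarz_polys n).2.[0] = 1 by case.
elim: n => [|n [IH1 IH2]] /=; first by rewrite -polyC1 !hornerC.
by rewrite !hornerE IH1; split=> //; ring.
Qed.

(** The eigenvector equations, solved for (v (j+1), p (j+1)) from (v j, p j) and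
    started at p 0 = 0; the remaining equation is v n = 0. *)
Fixpoint transfer_orbit (l : K) n : K * K :=
  if n is m.+1 then
    let s := transfer_orbit l m in
    let p := (b * s.1 + a * s.2) / l in ((l * s.1 - b * p) / a, p)
  else (1, 0).

Lemma root_schwarz_poly_eigenvalue n (l : K) : (0 < n)%N -> a != 0 -> l != 0 ->
  root (schwarz_poly n) (l ^- 2) ->
  eigenvalue (toeplitz n a b) l.
Proof.
move=> n0 a0 l0 /rootP qn0.
pose st := transfer_orbit l.
have stE m : (st m).1 = (l / a) ^+ m * (schwarz_polys m).1.[l ^- 2] /\
    b * (st m).2 = a * (l / a) ^+ m *
      ((schwarz_polys m).2.[l ^- 2] - (schwarz_polys m).1.[l ^- 2]).
  elim: m => [|m [IHv IHp]] /=; first by rewrite -polyC1 !hornerC; split; ring.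
  rewrite -/st.
  have -> : b * ((b * (st m).1 + a * (st m).2) / l) =
      (b ^+ 2 * (st m).1 + a * (b * (st m).2)) / l by ring.
  rewrite !(hornerD, hornerN, hornerM, hornerC, hornerX).
  rewrite IHv IHp !exprS; split; field; rewrite ?a0 ?l0 //.
apply/eigenvalueP; exists (interface_row n (fun j => (st j).1) (fun j => (st j).2)).
  rewrite interface_row_mul //; last first.
    by rewrite (stE n).1 -/(schwarz_poly n) qn0 mulr0.
  rewrite interface_rowZ.
  by apply/eq_interface_row => j jn /=; split; field; rewrite ?a0 ?l0.
rewrite -(interface_row0 K n).
by apply/eqP => /eq_interface_row /(_ _ n0) [/eqP]; rewrite oner_eq0.
Qed.

End SchwarzPoly.

Lemma eq_schwarz_poly (K : fieldType) (a b c : K) n :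
  b ^+ 2 = c ^+ 2 -> schwarz_poly a b n = schwarz_poly a c n.
Proof.
by move=> bc; rewrite /schwarz_poly; congr _.1; elim: n => //= n ->; rewrite bc.
Qed.


Lemma leq_expn3_bin n : (n ^ 3 <= 6 * 'C(n.+2, 3))%N.
Proof.
have -> : (6 * 'C(n.+2, 3) = n.+2 ^_ 3)%N by rewrite mulnC -bin_ffact.
rewrite !ffactnS ffactn0 !expnS expn0 /= !muln1.
by apply: leq_mul; [lia | apply: leq_mul; lia].
Qed.

(** * Eigenvalues approach the radius of a + b *)

Section DoublePoint.
Variables (K : fieldType) (a b : K).
Hypotheses (a0 : a != 0) (ab0 : a + b != 0).

Let w := a / (a + b).
Let beta := b / (a + b).
Let kappa := - (b ^+ 2 * (a + b) / a).

(** At (a + b)^-2 the characteristic equation of the recurrence has the double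
    root w, so that Q_n is w^n times an affine function of n.  The recurrence
    for the derivative has the same homogeneous part and a forcing term affine
    in n, which yields a cubic polynomial in n. *)
Lemma schwarz_poly_double_point n :
  (schwarz_poly a b n).[(a + b) ^- 2] = w ^+ n * (1 + n%:R * beta) /\
  (schwarz_poly a b n)^`().[(a + b) ^- 2] = w ^+ n * (kappa * 'C(n.+2, 3)%:R).
Proof.
pose t := (a + b) ^- 2.
rewrite /schwarz_poly.
suff [-> _ -> _] : [/\ (schwarz_polys a b n).1.[t] = w ^+ n * (1 + n%:R * beta),
  w * (schwarz_polys a b n).2.[t] = w ^+ n * (1 + n%:R * beta - beta),
  (schwarz_polys a b n).1^`().[t] = w ^+ n * (kappa * 'C(n.+2, 3)%:R) &
  w * (schwarz_polys a b n).2^`().[t] = w ^+ n * (kappa * 'C(n.+1, 3)%:R)] by [].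
elim: n => [|n [IH1 IH2 IH3 IH4]] /=.
  rewrite -polyC1 derivC !hornerC !bin_small //; split; try ring.
  by rewrite /w /beta; field.
have w0 : w != 0 by rewrite mulf_neq0 ?invr_eq0.
have e1 : 1 + (a ^+ 2 - b ^+ 2) * t = 2 * w by rewrite /t /w; field.
have e2 : a ^+ 2 * t = w ^+ 2 by rewrite /t /w; field.
have IH2' : (schwarz_polys a b n).2.[t] = w ^+ n * (1 + n%:R * beta - beta) / w.
  by rewrite -IH2; field.
have IH4' : (schwarz_polys a b n).2^`().[t] = w ^+ n * (kappa * 'C(n.+1, 3)%:R) / w.
  by rewrite -IH4; field.
rewrite derivB !derivM !derivD !derivM !derivC derivX -?polyC1 ?derivC.
rewrite !(hornerD, hornerN, hornerM, hornerC, hornerX) !(add0r, mul0r, mulr1).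
rewrite e1 e2 IH1 IH3 IH2' IH4' -[n.+1%:R]natr1 [w ^+ n.+1]exprS.
rewrite !binS bin0 bin1.
rewrite !natrD; move: (w ^+ n) 'C(n, 3)%:R 'C(n, 2)%:R => W C3 C2.
split; try (by field); try (by ring).
by rewrite /kappa /beta /w; field; rewrite a0.
Qed.

End DoublePoint.

Section EigenvalueNearDoublePoint.
Variables (K : numClosedFieldType) (a b c r : K).
Hypotheses (a0 : a != 0) (b0 : b != 0) (bc : c ^+ 2 = b ^+ 2).
Hypotheses (r0 : 0 < r) (rab : r < `|a + b|).

(** Compares the size n^2 of the logarithmic derivative at (a + b)^-2 with the
    bound n / d that holds when no root lies within d.  As Q_n depends on b
    through b^2 only, the matrices with b and - b have the same eigenvalues;
    with c = - b this covers a - b as well. *)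
Lemma eigenvalue_near_double_point : exists2 C : K, 0 <= C &
  forall n, C < n%:R -> exists2 l, r < `|l| &
    eigenvalue (toeplitz n a c) l.
Proof.
have ab_gt0 : 0 < `|a + b| := lt_trans r0 rab.
have ab0 : a + b != 0 by rewrite -normr_gt0.
pose t := (a + b) ^- 2; pose beta := b / (a + b).
pose kappa := - (b ^+ 2 * (a + b) / a).
have kappa0 : 0 < `|kappa|.
  by rewrite normr_gt0 oppr_eq0 !mulf_neq0 ?expf_neq0 ?invr_eq0.
pose d := r ^- 2 - `|t|.
have d0 : 0 < d.
  rewrite subr_gt0 /t normfV normrX ltf_pV2 ?posrE ?exprn_gt0 //.
  by rewrite ltr_pXn2r ?nnegrE ?(ltW r0).
have C0 : 0 <= 6 * (1 + `|beta|) / (d * `|kappa|).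
  apply: divr_ge0; last by rewrite mulr_ge0 // ltW.
  by rewrite mulr_ge0 // addr_ge0.
(* Absence of roots within d of t would give
   d |kappa| n^3 / 6 <= d |Q_n'(t) / w^n| <= n |1 + n beta| <= n^2 (1 + |beta|). *)
exists (6 * (1 + `|beta|) / (d * `|kappa|)) => // n Cn.
have n0 : (0 < n)%N.
  by rewrite -(ltr0n K); apply: le_lt_trans Cn.
have [s qE] := closed_field_poly_normal (schwarz_poly a b n).
set lc := lead_coef _ in qE.
have q0 : schwarz_poly a b n != 0.
  by apply/eqP => q0; have := schwarz_poly_at0 a b n; rewrite q0 horner0 => /eqP;
     rewrite eq_sym oner_eq0.
have lc0 : lc != 0 by rewrite lead_coef_eq0.
have root_s z : z \in s -> root (schwarz_poly a b n) z.
  by move=> zs; rewrite qE rootZ // root_prod_XsubC.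
have size_s : (size s <= n)%N.
  have := size_schwarz_poly a b n.
  by rewrite qE size_scale // size_prod_XsubC ltnS.
have [/hasP [z zs zr]|/hasPn far] := boolP (has (fun z => `|z| < r ^- 2) s).
  have z0 : z != 0.
    apply/eqP => z0; move: (root_s _ zs); rewrite z0 /root schwarz_poly_at0.
    by rewrite oner_eq0.
  pose l := sqrtC z^-1.
  have l2 : l ^- 2 = z by rewrite sqrtCK invrK.
  have l0 : l != 0 by rewrite sqrtC_eq0 invr_eq0.
  exists l; last first.
    apply: root_schwarz_poly_eigenvalue => //.
    by rewrite l2 (eq_schwarz_poly _ _ bc) root_s.
  rewrite -(ltr_pXn2r (ltn0Sn 1)) ?nnegrE ?(ltW r0) //.
  rewrite -ltf_pV2 ?posrE ?exprn_gt0 ?normr_gt0 //.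
  by rewrite -normrX -normfV l2.
exfalso.
(* Otherwise all the roots are far from t; contradiction for large n. *)
have fard z : z \in s -> d <= `|t - z|.
  move=> zs; rewrite distrC; apply: le_trans (lerB_dist _ _).
  by rewrite lerD2r real_leNgt ?far // ger0_real // invr_ge0 exprn_ge0 ?ltW.
have := norm_deriv_prod_le (ltW d0) fard.
rewrite -(ler_pM2l (x := `|lc|)) ?normr_gt0 // mulrCA -normrM.
rewrite [leRHS]mulrCA -normrM -!hornerZ -derivZ -qE.
have [-> ->] := @schwarz_poly_double_point _ _ b a0 ab0 n.
rewrite -/beta -/kappa !normrM normr_nat.
set w := `|_ ^+ n|.
have w0 : 0 < w by rewrite normr_gt0 expf_neq0 // mulf_neq0 ?invr_eq0.
rewrite mulrCA [leRHS]mulrCA ler_pM2l //.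
apply/negP; rewrite -real_ltNge ?ger0_real //; last by rewrite mulr_ge0 // ltW.
have n_gt0 : 0 < n%:R :> K by rewrite ltr0n.
have n_ge1 : 1 <= n%:R :> K by rewrite ler1n.
have C3 : n%:R ^+ 3 <= 6 * 'C(n.+2, 3)%:R :> K.
  by rewrite -natrX -natrM ler_nat leq_expn3_bin.
have bnd : `|1 + n%:R * beta| <= n%:R * (1 + `|beta|).
  apply: le_trans (ler_normD _ _) _.
  by rewrite normr1 normrM normr_nat mulrDr mulr1 lerD2r.
rewrite -(@ltr_pM2l K 6) //.
apply: (@le_lt_trans _ _ (6 * (n%:R * (n%:R * (1 + `|beta|))))).
  rewrite ler_pM2l // ler_pM // ?ler_nat //.
move: Cn; rewrite ltr_pdivrMr ?mulr_gt0 // => Cn.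
apply: (@lt_le_trans _ _ (d * (`|kappa| * n%:R ^+ 3))); last first.
  by rewrite [leRHS]mulrCA ler_pM2l // [leRHS]mulrCA ler_pM2l.
have -> : d * (`|kappa| * n%:R ^+ 3) = n%:R ^+ 2 * (n%:R * (d * `|kappa|)) by ring.
have -> : 6 * (n%:R * (n%:R * (1 + `|beta|))) = n%:R ^+ 2 * (6 * (1 + `|beta|)).
  by ring.
by rewrite ltr_pM2l // exprn_gt0.
Qed.

End EigenvalueNearDoublePoint.

(** * Limit of the spectral radius for many subdomains *)

Section SpectralRadius.
Variable R : realType.
Implicit Types (a b l : R[i]) (r : R).


Lemma normrc l : `|l| = (normc l)%:C.
Proof. by []. Qed.

Lemma normc_ge0 l : 0 <= normc l.
Proof. by rewrite -ler0c -normrc. Qed.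

Lemma normc_gt0 l : (0 < normc l) = (l != 0).
Proof. by rewrite -ltcR -normrc rmorph0 normr_gt0. Qed.

(** The maximum over theta of the spectral radius of the symbol of the matrix:
    its eigenvalues l satisfy l + (a^2 - b^2) / l = 2 a cos theta, and |l| is
    largest at cos theta = 1 or - 1, where l = +- a +- b. *)
Definition symbol_radius a b : R := Num.max (normc (a + b)) (normc (a - b)).

Lemma symbol_radius_ge0 a b : 0 <= symbol_radius a b.
Proof. by rewrite le_max !normc_ge0. Qed.

Lemma eigenvalue_le_symbol_radius n a b l :
  eigenvalue (toeplitz n a b) l -> normc l <= symbol_radius a b.
Proof.
move=> /(@eigenvalue_toeplitz_le _ _ _ _ (symbol_radius a b)%:C).
by rewrite !normrc !lecR !le_max !lexx orbT; apply.
Qed.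

Lemma spectral_radius_toeplitz_le n a b :
  spectral_radius (toeplitz n a b) <= symbol_radius a b.
Proof.
rewrite /spectral_radius; set E := [set _ | _ in _].
have [->|/set0P E0] := eqVneq E set0; first by rewrite sup0 symbol_radius_ge0.
by apply: ge_sup => // _ [l /= /eigenvalue_le_symbol_radius ? <-].
Qed.

Lemma eigenvalue_le_spectral_radius n a b l :
  eigenvalue (toeplitz n a b) l -> normc l <= spectral_radius (toeplitz n a b).
Proof.
move=> al; apply: ub_le_sup; last by exists l.
exists (symbol_radius a b) => _ [l' /= al' <-].
exact: eigenvalue_le_symbol_radius al'.
Qed.

Lemma spectral_radius_toeplitz_cvg a b : a != 0 -> b != 0 ->
  (fun n => spectral_radius (toeplitz n a b)) @ \oo --> symbol_radius a b.
Proof.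
move=> a0 b0; set s := symbol_radius a b.
have s0 : 0 < s.
  rewrite lt_max !normc_gt0 -negb_and; apply/negP => /andP[/eqP e1 /eqP e2].
  have bE : b = ((a + b) - (a - b)) / 2 by field.
  by move: b0; rewrite bE e1 e2 subrr mul0r eqxx.
apply/cvgrPdist_lt => e e0.
(* The maximum with s / 2 only ensures 0 < r. *)
pose r := Num.max (s - e) (s / 2).
have r0 : 0 < r by rewrite lt_max divr_gt0 ?orbT.
have rs : r < s by rewrite gt_max; apply/andP; split; lra.
have [C C0 CP] : exists2 C : R, 0 <= C & forall n, C < n%:R ->
    exists2 l, r < normc l & eigenvalue (toeplitz n a b) l.
  have [c [c2 rc]] : exists c, b ^+ 2 = c ^+ 2 /\ r < normc (a + c).
    by move: rs; rewrite lt_max => /orP[?|?]; [exists b|exists (- b)]; rewrite ?sqrrN.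
  have c0 : c != 0 by rewrite -sqrf_eq0 -c2 sqrf_eq0.
  have [||C C0 CP] := @eigenvalue_near_double_point _ a c b r%:C a0 c0 c2.
  - by rewrite -(rmorph0 (real_complex R)) ltcR.
  - by rewrite normrc ltcR.
  have CE : C = (complex.Re C)%:C by rewrite RRe_real // ger0_real.
  exists (complex.Re C) => [|n Cn]; first by rewrite -ler0c -CE.
  have [|l rl al] := CP n; first by rewrite CE -(rmorph_nat (real_complex R)) ltcR.
  by exists l => //; rewrite -ltcR.
near=> n.
have [|l rl /eigenvalue_le_spectral_radius lr] := CP n.
  by near: n; apply: nbhs_infty_gtr.
rewrite ger0_norm ?subr_ge0 ?spectral_radius_toeplitz_le //.
have := lt_le_trans rl lr; rewrite gt_max => /andP[+ _].
by rewrite ltrBlDr ltrBlDl.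
Unshelve. all: by end_near. Qed.

End SpectralRadius.

(** * Elementary inequalities on real functions *)

Section RealInequalities.
Variable R : realType.
Implicit Types t : R.

Lemma ge_of_derive_ge0 (f df : R -> R) t :
  (forall x : R, is_derive x 1 f (df x)) -> (forall x, 0 <= df x) -> 0 <= t ->
  f 0 <= f t.
Proof.
move=> fdf df0 t0.
have cf : {within `[0, t], continuous f}.
  apply: derivable_within_continuous => x _; by case: (fdf x).
have [c _ ft] := MVT_segment t0 (fun x _ => fdf x) cf.
by rewrite -subr_ge0 ft subr0 mulr_ge0.
Qed.

Lemma expR_sub_expRN_ge t : 0 <= t -> 2 * t <= expR t - expR (- t).
Proof.
move=> t0; rewrite -subr_ge0.
have fd (x : R) :
    is_derive x 1 (fun x : R => expR x - expR (- x) - 2 * x)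
              (expR x + expR (- x) - 2).
  by apply: is_derive_eq; rewrite /GRing.scale /=; ring.
have := @ge_of_derive_ge0 _ _ t fd _ t0.
rewrite oppr0 expR0 mulr0 subrr subr0; apply=> x.
have := mulfV (lt0r_neq0 (expR_gt0 x)); rewrite -expRN => e.
have := expR_gt0 x; have := expR_gt0 (- x).
move: (expR x) (expR (- x)) e => u v uv u0 v0; rewrite -(pmulr_rge0 _ v0).
have -> : u * (u + v - 2) = (u - 1) ^+ 2 + (u * v - 1) by ring.
by rewrite uv subrr addr0 sqr_ge0.
Qed.

Lemma norm_sin_le t : `|sin t| <= `|t|.
Proof.
wlog t0 : t / 0 <= t => [H|].
  have [/H//|/ltW t0] := leP 0 t.
  by rewrite -normrN -sinN -(normrN t) H // oppr_ge0.
rewrite (ger0_norm t0) ler_norml; apply/andP; split; rewrite -subr_ge0.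
  have fd (x : R) : is_derive x 1 (fun x : R => sin x + x) (cos x + 1).
    by apply: is_derive_eq; rewrite /GRing.scale /=; ring.
  have := @ge_of_derive_ge0 _ _ t fd _ t0; rewrite sin0 addr0 opprK; apply=> x.
  by have := cos_geN1 x; lra.
have fd (x : R) : is_derive x 1 (fun x : R => x - sin x) (1 - cos x).
  by apply: is_derive_eq; rewrite /GRing.scale /=; ring.
have := @ge_of_derive_ge0 _ _ t fd _ t0; rewrite sin0 subr0; apply=> x.
by rewrite subr_ge0 cos_le1.
Qed.

(** The inequality t <= sinh t, multiplied by 2 exp (- t). *)
Lemma two_mul_expRN_le t : 0 <= t -> 2 * t * expR (- t) <= 1 - expR (- t) ^+ 2.
Proof.
move=> /expR_sub_expRN_ge; rewrite -(ler_pM2r (expR_gt0 (- t))) => /le_trans; apply.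
by rewrite mulrBl -expRD subrr expR0 expr2.
Qed.

Lemma cosh_ge t : 0 <= t -> 2 + t ^+ 2 <= expR t + expR (- t).
Proof.
move=> t0; have t20 : 0 <= t / 2 by rewrite divr_ge0.
have e : expR (t / 2) * expR (- (t / 2)) = 1 by rewrite -expRD subrr expR0.
have -> : expR t = expR (t / 2) ^+ 2 by rewrite expr2 -expRD -splitr.
have -> : expR (- t) = expR (- (t / 2)) ^+ 2.
  by rewrite expr2 -expRD -opprD -splitr.
have : t ^+ 2 <= (expR (t / 2) - expR (- (t / 2))) ^+ 2.
  have := expR_sub_expRN_ge t20; rewrite mulrCA mulfV ?pnatr_eq0 // mulr1 => h.
  by rewrite lerXn2r // nnegrE // (le_trans t0 h).
rewrite sqrrB e; lra.
Qed.

(** The ratio of t to sinh t, uniformly below 1 for t >= t0 > 0, since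
    sinh t = 2 sinh (t / 2) cosh (t / 2). *)
Lemma two_mul_expRN_le_sharp t t0 : 0 <= t0 <= t ->
  2 * t * expR (- t) <= 2 / (2 + (t0 / 2) ^+ 2) * (1 - expR (- t) ^+ 2).
Proof.
move=> /andP[t00 t0t]; have tge0 := le_trans t00 t0t.
have t20 : 0 <= t / 2 by rewrite divr_ge0.
have D0 : 0 < 2 + (t0 / 2) ^+ 2 by rewrite ltr_pwDl // sqr_ge0.
rewrite [leRHS]mulrAC ler_pdivlMr //.
have e : expR (t / 2) * expR (- (t / 2)) = 1 by rewrite -expRD subrr expR0.
have -> : expR (- t) = expR (- (t / 2)) ^+ 2.
  by rewrite expr2 -expRD -opprD -splitr.
have h0 := expR_gt0 (- (t / 2)).
have h1 := two_mul_expRN_le t20; have h2 := cosh_ge t20.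
have h3 : (t0 / 2) ^+ 2 <= (t / 2) ^+ 2.
  by rewrite lerXn2r ?nnegrE ?divr_ge0 // ler_pM2r // invr_gt0.
move: (expR (t / 2)) (expR (- (t / 2))) e h0 h1 h2 => u v uv v0 h1 h2.
have h4 : (2 + (t0 / 2) ^+ 2) * v <= 1 + v ^+ 2.
  have : (2 + (t0 / 2) ^+ 2) * v <= (u + v) * v.
    by rewrite ler_wpM2r ?(ltW v0) //; lra.
  by rewrite [leRHS]mulrDl uv expr2.
have h5 : 2 * (t / 2) * v * ((2 + (t0 / 2) ^+ 2) * v) <=
    (1 - v ^+ 2) * (1 + v ^+ 2).
  apply: ler_pM => //; rewrite !mulr_ge0 ?(ltW v0) ?(ltW D0) //.
have -> : 2 * t * v ^+ 2 * (2 + (t0 / 2) ^+ 2) =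
  2 * (2 * (t / 2) * v * ((2 + (t0 / 2) ^+ 2) * v)) by field.
have -> : 2 * (1 - v ^+ 2 ^+ 2) = 2 * ((1 - v ^+ 2) * (1 + v ^+ 2)) by ring.
by rewrite ler_pM2l.
Qed.

End RealInequalities.

(** * Coefficients of the iteration matrix as Moebius expressions *)

Section ComplexExponential.
Variable R : realType.
Implicit Types (z w : R[i]) (x y t : R).

Lemma cexpD z w : cexp (z + w) = cexp z * cexp w.
Proof.
case: z w => [x y] [x' y']; rewrite /cexp /= expRD cosD sinD; simpc.
by apply/eqP; rewrite eq_complex /=; apply/andP; split; apply/eqP; ring.
Qed.

Lemma cexp0 : cexp 0 = 1 :> R[i].
Proof. by rewrite /cexp /= expR0 cos0 sin0 mulr0 mul1r. Qed.

Lemma normc_cexp z : normc (cexp z) = expR (complex.Re z).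
Proof.
rewrite /cexp /= !exprMn -mulrDr cos2Dsin2 mulr1.
by rewrite sqrtr_sqr ger0_norm ?expR_ge0.
Qed.

Lemma cexp_neq0 z : cexp z != 0.
Proof. by rewrite -normc_gt0 normc_cexp expR_gt0. Qed.

Lemma cexpN z : cexp (- z) = (cexp z)^-1.
Proof.
by apply: (mulfI (cexp_neq0 z)); rewrite -cexpD subrr cexp0 mulfV ?cexp_neq0.
Qed.

Lemma mulc_real x y t : (x +i* y) * t%:C = (x * t) +i* (y * t).
Proof. by simpc. Qed.

Lemma normc_sqrE x y : normc (x +i* y) ^+ 2 = x ^+ 2 + y ^+ 2.
Proof. by rewrite /= sqr_sqrtr // addr_ge0 ?sqr_ge0. Qed.

Lemma normcD z w : normc (z + w) <= normc z + normc w.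
Proof. by rewrite -lecR rmorphD -!normrc ler_normD. Qed.

Lemma normcB z w : normc (z - w) <= normc z + normc w.
Proof. by rewrite -lecR rmorphD -!normrc ler_normB. Qed.

Lemma normc_opp z : normc (- z) = normc z.
Proof. by apply: complexI; rewrite -!normrc normrN. Qed.

End ComplexExponential.

Section Coefficients.
Variable R : realType.
Implicit Types (z : R[i]) (x y L delta : R).

(** Decay of a mode over the distance L between consecutive subdomains. *)
Definition decay z L : R[i] := cexp (- (z * L%:C)).
(** The reflection coefficient of the Robin condition, times the decay across
    the overlap of width 2 delta. *)
Definition reflection z delta : R[i] :=
  (z - 'i) / (z + 'i) * cexp (- (2 * z * delta%:C)).

Lemma schwarz_coefE z L delta :
  let e := decay z L in let h := reflection z delta in
  z + 'i != 0 -> 1 - (h * e) ^+ 2 != 0 ->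
  schwarz_a 'i z L delta = e * (1 - h ^+ 2) / (1 - (h * e) ^+ 2) /\
  schwarz_b 'i z L delta = - (h * (1 - e ^+ 2) / (1 - (h * e) ^+ 2)).
Proof.
move=> e h p0; rewrite /schwarz_a /schwarz_b /schwarz_den.
have -> : z * (2 * delta + L)%:C = 2 * z * delta%:C + z * L%:C.
  by rewrite rmorphD rmorphM rmorph_nat; ring.
have -> : z ^+ 2 - 'i ^+ 2 = (z + 'i) * (z - 'i) by ring.
rewrite /e /h /decay /reflection !cexpN !cexpD.
have := cexp_neq0 (z * L%:C); have := cexp_neq0 (2 * z * delta%:C).
move: (cexp (z * L%:C)) (cexp (2 * z * delta%:C))
  (z - 'i) (z + 'i) p0 => E F q p p0 F0 E0 d0.
have d1 : (p * F * E) ^+ 2 - q ^+ 2 != 0.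
  apply: contra d0 => /eqP d0; apply/eqP.
  have -> : 1 - (q / p / F / E) ^+ 2 =
    ((p * F * E) ^+ 2 - q ^+ 2) / ((p * F * E) ^+ 2).
    by field; rewrite p0 F0 E0.
  by rewrite d0 mul0r.
by split; field; rewrite ?p0 ?F0 ?E0 ?d0 ?d1.
Qed.

Section RightHalfPlane.
Variables (x y L delta : R).
Hypotheses (x0 : 0 < x) (y0 : 0 < y) (L0 : 0 < L) (delta0 : 0 < delta).
Let z : R[i] := x +i* y.
Let e := decay z L.
Let h := reflection z delta.

Lemma decayE : e = (expR (- (x * L)) * cos (y * L)) +i*
                   (- (expR (- (x * L)) * sin (y * L))).
Proof.
by rewrite /e /decay mulc_real /cexp /= cosN sinN mulrN.
Qed.

Lemma normc_decay : normc e = expR (- (x * L)).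
Proof. by rewrite /e /decay mulc_real normc_cexp. Qed.

Lemma mobiusE : let D := x ^+ 2 + y ^+ 2 + 1 + 2 * y in
  (z - 'i) / (z + 'i) = ((x ^+ 2 + y ^+ 2 - 1) / D) +i* (- (2 * x / D)).
Proof.
move=> D; have D0 : 0 < D.
  by rewrite ltr_pwDr ?mulr_gt0 // addr_ge0 // addr_ge0 ?sqr_ge0.
have p0 : z + 'i != 0.
  by rewrite eq_complex /= addr0 (gt_eqF x0).
apply: (mulIf p0); rewrite divfK //.
rewrite /z; simpc; apply/eqP; rewrite eq_complex /=.
by apply/andP; split; apply/eqP; rewrite /D; field; rewrite gt_eqF.
Qed.

Lemma reflectionE : let D := x ^+ 2 + y ^+ 2 + 1 + 2 * y in
  let M := x ^+ 2 + y ^+ 2 in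
  let c := cos (2 * y * delta) in let s := sin (2 * y * delta) in
  let f := expR (- (2 * x * delta)) in
  h = (f / D * ((M - 1) * c - 2 * x * s)) +i*
      (- (f / D * ((M - 1) * s + 2 * x * c))).
Proof.
move=> D M c s f; rewrite /h /reflection mobiusE -/D.
have -> : 2 * z = (2 * x) +i* (2 * y).
  rewrite -(rmorph_nat (real_complex R) 2) mulrC mulc_real.
  by rewrite [x * _]mulrC [y * _]mulrC.
rewrite mulc_real /cexp /= cosN sinN -/f -/c -/s; simpc.
apply/eqP; rewrite eq_complex /=.
by apply/andP; split; apply/eqP; rewrite /M; ring.
Qed.

Lemma normc_reflection_sqr :
  let M := x ^+ 2 + y ^+ 2 in
  normc h ^+ 2 =
  (M + 1 - 2 * y) / (M + 1 + 2 * y) * expR (- (2 * x * delta)) ^+ 2.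
Proof.
move=> M; rewrite reflectionE normc_sqrE /=.
have := cos2Dsin2 (2 * y * delta); move: (cos _) (sin _) (expR _) => c s f cs.
have D0 : 0 < M + 1 + 2 * y.
  by rewrite ltr_pwDr ?mulr_gt0 // addr_ge0 // addr_ge0 ?sqr_ge0.
have -> : (M + 1 - 2 * y) / (M + 1 + 2 * y) * f ^+ 2 =
  (f / (M + 1 + 2 * y)) ^+ 2 * ((M - 1) ^+ 2 + (2 * x) ^+ 2) * (c ^+ 2 + s ^+ 2).
  rewrite cs mulr1.
  have -> : (M - 1) ^+ 2 + (2 * x) ^+ 2 = (M + 1 - 2 * y) * (M + 1 + 2 * y).
    by rewrite /M; ring.
  by field; rewrite gt_eqF.
by rewrite /M; ring.
Qed.

Lemma normc_reflection_le : normc h <= expR (- (2 * x * delta)).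
Proof.
rewrite -ler_sqr ?nnegrE ?expR_ge0 ?normc_ge0 // normc_reflection_sqr.
rewrite ler_piMl ?sqr_ge0 // ler_pdivrMr ?mul1r.
  by rewrite lerD2l; have := y0; lra.
by rewrite ltr_pwDr ?mulr_gt0 // addr_ge0 // addr_ge0 ?sqr_ge0.
Qed.

Lemma decay_im_le : 2 * `|complex.Im e| * (x * L) <= 1 - normc e ^+ 2.
Proof.
rewrite normc_decay; apply: le_trans (two_mul_expRN_le _); last first.
  by rewrite mulr_ge0 ?ltW.
rewrite mulrAC ler_pM2l ?mulr_gt0 // decayE /= normrN normrM.
by rewrite (ger0_norm (expR_ge0 _)) ler_piMr ?expR_ge0 // sin_max.
Qed.

(** Bounding the sine in Im e by y L instead of 1 gives the ratio y / x, with a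
    factor less than 1 as long as x is bounded below by t > 0. *)
Lemma decay_im_le_sharp (t : R) : 0 <= t <= x ->
  2 * x * `|complex.Im e| <=
  2 / (2 + (t * L / 2) ^+ 2) * y * (1 - normc e ^+ 2).
Proof.
move=> /andP[t0 tx]; rewrite normc_decay decayE /= normrN normrM.
rewrite (ger0_norm (expR_ge0 _)).
have /two_mul_expRN_le_sharp : 0 <= t * L <= x * L.
  by rewrite mulr_ge0 ?(ltW L0) //= ler_pM2r.
rewrite -(ler_pM2l y0) => h1.
have h2 : `|sin (y * L)| <= y * L.
  by apply: le_trans (norm_sin_le _) _; rewrite ger0_norm // ltW // mulr_gt0.
rewrite [leRHS]mulrAC [leRHS]mulrC; apply: le_trans h1.
have -> : y * (2 * (x * L) * expR (- (x * L))) =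
  2 * x * expR (- (x * L)) * (y * L) by ring.
rewrite [leLHS]mulrA; apply: ler_wpM2l h2.
by rewrite !mulr_ge0 ?expR_ge0 ?ltW.
Qed.

Lemma reflection_im_le : 2 * `|complex.Im h| * (2 * x * delta) <= 1 - normc h ^+ 2.
Proof.
have f0 : 0 <= 2 * x * delta by rewrite !mulr_ge0 ?ltW.
have hf := normc_reflection_le.
have im : `|complex.Im h| <= normc h.
  rewrite -[normc h]ger0_norm ?normc_ge0 // -ler_sqr ?nnegrE //.
  rewrite !real_normK ?num_real //.
  by case: h => u v; rewrite normc_sqrE /= lerDr sqr_ge0.
have := two_mul_expRN_le f0; move: (expR _) hf => f hf hff.
have h0 := normc_ge0 h; rewrite -subr_ge0.
have -> : 1 - normc h ^+ 2 - 2 * `|complex.Im h| * (2 * x * delta) =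
  (1 - f ^+ 2 - 2 * (2 * x * delta) * f) + (f - normc h) * (f + normc h) +
  2 * (2 * x * delta) * (f - `|complex.Im h|) by ring.
apply: addr_ge0; first apply: addr_ge0.
- by rewrite subr_ge0.
- by rewrite mulr_ge0 ?subr_ge0 // addr_ge0 // (le_trans h0 hf).
- by rewrite mulr_ge0 ?subr_ge0 ?(le_trans im hf) // mulr_ge0.
Qed.

(** The counterpart for h, with the inverse ratio x / y.  Bounding sine and
    cosine by their argument and by 1 leaves
    y^2 (M - 1) <= x^2 (M + 1) with M = x^2 + y^2, that is, y^2 - x^2 <= 1. *)
Lemma reflection_im_le_sharp :
  y ^+ 2 - x ^+ 2 <= 1 -> 1 <= x ^+ 2 + y ^+ 2 ->
  2 * y * `|complex.Im h| <= x * (1 - normc h ^+ 2).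
Proof.
move=> yx M1; rewrite normc_reflection_sqr reflectionE /= normrN.
set M := x ^+ 2 + y ^+ 2; set f := expR _; set c := cos _; set s := sin _.
have f0 : 0 < f by rewrite expR_gt0.
have D0 : 0 < M + 1 + 2 * y.
  by rewrite ltr_pwDr ?mulr_gt0 // addr_ge0 // addr_ge0 ?sqr_ge0.
have hs : `|s| <= 2 * y * delta.
  by apply: le_trans (norm_sin_le _) _; rewrite ger0_norm // !mulr_ge0 ?ltW.
have hc : `|c| <= 1 by rewrite ler_norml cos_geN1 cos_le1.
have hf := two_mul_expRN_le (_ : 0 <= 2 * x * delta).
have {}hf : 2 * (2 * x * delta) * f <= 1 - f ^+ 2.
  by apply: hf; rewrite !mulr_ge0 ?ltW.
have hf2 : 2 * f <= 1 + f ^+ 2.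
  by rewrite -subr_ge0 (_ : _ - _ = (f - 1) ^+ 2) ?sqr_ge0 //; ring.
rewrite normrM ger0_norm ?divr_ge0 ?(ltW f0) ?(ltW D0) //.
have -> : x * (1 - (M + 1 - 2 * y) / (M + 1 + 2 * y) * f ^+ 2) =
  x * ((M + 1) * (1 - f ^+ 2) + 2 * y * (1 + f ^+ 2)) / (M + 1 + 2 * y).
  by field; rewrite gt_eqF.
set Y := `|_ + _|.
have -> : 2 * y * (f / (M + 1 + 2 * y) * Y) = 2 * y * f * Y / (M + 1 + 2 * y).
  by ring.
rewrite ler_pM2r ?invr_gt0 //.
have h1 : Y <= (M - 1) * (2 * y * delta) + 2 * x.
  apply: le_trans (ler_normD _ _) _; rewrite !normrM; apply: lerD.
    by rewrite ger0_norm ?subr_ge0 // ler_wpM2l // subr_ge0.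
  by rewrite (ger0_norm (ltW x0)) normr_nat ler_piMr // mulr_ge0 // ltW.
apply: (@le_trans _ _ (2 * y * f * ((M - 1) * (2 * y * delta) + 2 * x))).
  by rewrite ler_pM2l // !mulr_gt0.
apply: (@le_trans _ _
    (x * ((M + 1) * (2 * (2 * x * delta) * f) + 2 * y * (2 * f)))).
  rewrite -subr_ge0.
  have -> : x * ((M + 1) * (2 * (2 * x * delta) * f) + 2 * y * (2 * f)) -
      2 * y * f * ((M - 1) * (2 * y * delta) + 2 * x) =
      4 * delta * f * (M * (1 - (y ^+ 2 - x ^+ 2))) by rewrite /M; ring.
  by rewrite !mulr_ge0 ?(ltW f0) ?(ltW delta0) ?subr_ge0 // (le_trans ler01 M1).
rewrite ler_pM2l //; apply: lerD.
  by rewrite ler_wpM2l // addr_ge0 // (le_trans ler01 M1).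
by rewrite ler_wpM2l // mulr_ge0 ?ltW.
Qed.

End RightHalfPlane.
End Coefficients.

(** * Removing the wave number by scaling *)

Section PrincipalRoot.
Variable R : realType.
Implicit Types (u v k sigma s : R).

Lemma sqrtc_re_im_gt0 u v : 0 < v ->
  exists x y, [/\ sqrtc (u +i* v) = x +i* y, 0 < x, 0 < y,
                  x ^+ 2 - y ^+ 2 = u & 2 * x * y = v].
Proof.
move=> v0; have := sqr_sqrtc (u +i* v).
have : 0 <= complex.Re (sqrtc (u +i* v)) by rewrite /= sqrtr_ge0.
case: (sqrtc _) => x y /= x0 e; exists x, y; move: e.
rewrite expr2; simpc => /eqP; rewrite eq_complex /= => /andP[/eqP eu /eqP ev].
have xy : 0 < x * y by move: ev; rewrite mulrC; lra.
have x1 : 0 < x.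
  by rewrite lt0r x0 andbT; apply: contraTneq xy => ->; rewrite mul0r ltxx.
split=> //; first by rewrite -(pmulr_rgt0 _ x1).
by rewrite -ev; ring.
Qed.

Lemma sqrtc_pos_scale k u v : 0 < k -> 0 < v ->
  sqrtc ((k ^+ 2 * u) +i* (k ^+ 2 * v)) = k%:C * sqrtc (u +i* v).
Proof.
move=> k0 v0.
have k2v : 0 < k ^+ 2 * v by rewrite mulr_gt0 ?exprn_gt0.
have := sqr_sqrtc ((k ^+ 2 * u) +i* (k ^+ 2 * v)); have := sqr_sqrtc (u +i* v).
have [x [y [-> x0 _ _ _]]] := sqrtc_re_im_gt0 (k ^+ 2 * u) k2v.
have [x' [y' [-> x'0 _ _ _]]] := sqrtc_re_im_gt0 u v0 => e1 e2.
have /eqP : (x +i* y) ^+ 2 = (k%:C * (x' +i* y')) ^+ 2.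
  rewrite exprMn e1 e2 expr2; simpc.
  by apply/eqP; rewrite eq_complex /=; apply/andP; split; apply/eqP; ring.
(* Of the two square roots, only one has a positive real part. *)
rewrite eqf_sqr => /orP[/eqP //|/eqP]; simpc => -[xE _].
have kx : 0 < k * x' by rewrite mulr_gt0.
by move: x0; rewrite xE oppr_gt0 => /(lt_trans kx); rewrite ltxx.
Qed.

Lemma zeta_scale k sigma s : 0 < k -> 0 < sigma ->
  zeta k (sigma * k) s = k%:C * zeta 1 sigma (s / k).
Proof.
move=> k0 sigma0; rewrite /zeta mul1r expr1n -sqrtc_pos_scale //.
by congr (sqrtc (_ +i* _)); field; rewrite ?gt_eqF.
Qed.

Lemma zeta_re_im sigma s : 0 < sigma ->
  exists x y, [/\ zeta 1 sigma s = x +i* y, 0 < x, 0 < y,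
                  x ^+ 2 - y ^+ 2 = s ^+ 2 - 1 & 2 * x * y = sigma].
Proof.
by move=> sigma0; rewrite /zeta mul1r expr1n; apply: sqrtc_re_im_gt0.
Qed.

(** Since y^2 <= x^2 + 1, the identity (2 x y)^2 = sigma^2 gives
    (2 x^2 + 1)^2 >= 1 + sigma^2 whatever s is. *)
Lemma zeta_re_ge sigma s x y : 0 < x -> 0 < y ->
  x ^+ 2 - y ^+ 2 = s ^+ 2 - 1 -> 2 * x * y = sigma ->
  (Num.sqrt (1 + sigma ^+ 2) - 1) / 2 <= x ^+ 2.
Proof.
move=> x0 y0 eu ev.
rewrite ler_pdivrMr // lerBlDr.
have X0 : 0 <= x ^+ 2 * 2 + 1 by rewrite addr_ge0 // mulr_ge0 // sqr_ge0.
rewrite -(ger0_norm X0) -sqrtr_sqr ler_sqrt ?sqr_ge0 // -ev -subr_ge0.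
have -> : (x ^+ 2 * 2 + 1) ^+ 2 - (1 + (2 * x * y) ^+ 2) =
  4 * x ^+ 2 * (x ^+ 2 - y ^+ 2 + 1) by ring.
rewrite eu subrK; apply: mulr_ge0; last exact: sqr_ge0.
by apply: mulr_ge0; last exact: sqr_ge0.
Qed.

End PrincipalRoot.

Section ScaleFreeCoefficients.
Variable R : realType.
Implicit Types (k sigma s L delta : R).

Lemma schwarz_coef_scale (z : R[i]) k L delta : 0 < k ->
  schwarz_a (0 +i* k) (k%:C * z) (L / k) (delta / k) = schwarz_a 'i z L delta /\
  schwarz_b (0 +i* k) (k%:C * z) (L / k) (delta / k) = schwarz_b 'i z L delta.
Proof.
move=> k0.
have -> : 0 +i* k = k%:C * 'i by simpc.
have scaleK (t : R) : k%:C * z * (t / k)%:C = z * t%:C.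
  by rewrite mulrAC -rmorphM mulrC mulrCA mulfV ?gt_eqF // mulr1.
have kC0 : k%:C != 0.
  by rewrite -(rmorph0 (real_complex R)) (inj_eq (@complexI R)) gt_eqF.
rewrite /schwarz_a /schwarz_b /schwarz_den.
have -> : 2 * (delta / k) + L / k = (2 * delta + L) / k by ring.
rewrite !scaleK -[2 * (k%:C * z) * _]mulrA scaleK [2 * (z * _)]mulrA.
have kD E : (k%:C * z + k%:C * 'i) ^+ 2 * E = k%:C ^+ 2 * ((z + 'i) ^+ 2 * E).
  by ring.
have kB E : (k%:C * z - k%:C * 'i) ^+ 2 * E = k%:C ^+ 2 * ((z - 'i) ^+ 2 * E).
  by ring.
have kS : (k%:C * z) ^+ 2 - (k%:C * 'i) ^+ 2 = k%:C ^+ 2 * (z ^+ 2 - 'i ^+ 2).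
  by ring.
have cancel X Y : k%:C ^+ 2 * X / (k%:C ^+ 2 * Y) = X / Y.
  by rewrite invfM mulrACA mulfV ?expf_neq0 // mul1r.
rewrite !kD !kB kS -!mulrBr -[k%:C ^+ 2 * _ * (_ - _)]mulrA.
by split; rewrite cancel.
Qed.

(** The value R_1d of the limiting convergence factor as a function of
    s = ktilde / k. *)
Definition damping_rate sigma L delta s : R :=
  symbol_radius (schwarz_a 'i (zeta 1 sigma s) L delta)
                (schwarz_b 'i (zeta 1 sigma s) L delta).

Lemma T1d_scale k sigma L delta s N : 0 < k -> 0 < sigma ->
  T1d (0 +i* k) k (sigma * k) (L / k) (delta / k) s N =
  toeplitz N.-1 (schwarz_a 'i (zeta 1 sigma (s / k)) L delta)
    (schwarz_b 'i (zeta 1 sigma (s / k)) L delta).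
Proof.
move=> k0 sigma0; rewrite /T1d zeta_scale //.
by have [-> ->] := schwarz_coef_scale (zeta 1 sigma (s / k)) L delta k0.
Qed.

End ScaleFreeCoefficients.

(** * Uniform bounds on the convergence factor *)

Section MobiusContraction.
Variable R : realType.
Implicit Types (e h : R[i]).

Lemma normc_mul_lt1 e h : normc e < 1 -> normc h < 1 -> normc (h * e) < 1.
Proof.
move=> e1 h1; rewrite ComplexField.Normc.normcM.
by rewrite mulr_ilt1 ?normc_ge0.
Qed.

Lemma one_sub_neq0 (w : R[i]) : normc w < 1 -> 1 - w != 0.
Proof.
by apply: contraTneq => /subr0_eq <-; rewrite ComplexField.Normc.normc1 ltxx.
Qed.

(** The identity
    |1 - h e|^2 - |e - h|^2 = (1 - |e|^2) (1 - |h|^2) + 4 Im e Im h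
    together with |1 - h e| <= 2.  The hypothesis is symmetric in h and - h. *)
Lemma mobius_contraction e h theta : normc e < 1 -> normc h < 1 -> theta <= 1 ->
  4 * (`|complex.Im e| * `|complex.Im h|) <=
    theta * ((1 - normc e ^+ 2) * (1 - normc h ^+ 2)) ->
  normc ((e - h) / (1 - h * e)) ^+ 2 <=
    1 - (1 - theta) * ((1 - normc e ^+ 2) * (1 - normc h ^+ 2)) / 4.
Proof.
move=> e1 h1 t1 ethP.
have P0 : 0 <= (1 - normc e ^+ 2) * (1 - normc h ^+ 2).
  by rewrite mulr_ge0 // subr_ge0 expr_le1 ?normc_ge0 // ltW.
have hD := one_sub_neq0 (normc_mul_lt1 e1 h1).
have D0 : 0 < normc (1 - h * e) ^+ 2 by rewrite exprn_gt0 // normc_gt0.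
have D4 : normc (1 - h * e) ^+ 2 <= 4.
  have -> : 4 = 2 ^+ 2 :> R by ring.
  rewrite lerXn2r ?nnegrE ?normc_ge0 //; apply: le_trans (normcB _ _) _.
  rewrite ComplexField.Normc.normc1; have := normc_mul_lt1 e1 h1; lra.
have XE : normc (1 - h * e) ^+ 2 - normc (e - h) ^+ 2 =
    (1 - normc e ^+ 2) * (1 - normc h ^+ 2) + 4 * (complex.Im e * complex.Im h).
  clear; case: e h => [a b] [c d]; rewrite -[1 : R[i]]/(1 +i* 0); simpc.
  by rewrite !normc_sqrE /=; ring.
set P := _ * _ in P0 ethP XE *.
have eh : - (`|complex.Im e| * `|complex.Im h|) <= complex.Im e * complex.Im h.
  by rewrite -normrM lerNl -normrN ler_norm.
rewrite ComplexField.Normc.normcM ComplexField.Normc.normcV exprMn exprVn.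
rewrite ler_pdivrMr // mulrBl mul1r lerBrDr -lerBrDl XE.
have tP : 0 <= (1 - theta) * P by rewrite mulr_ge0 // subr_ge0.
apply: (@le_trans _ _ ((1 - theta) * P)).
  by rewrite -[leLHS]mulrA ler_piMr // ler_pdivrMl // mulr1.
by move: ethP eh; rewrite mulrBl mul1r; lra.
Qed.

End MobiusContraction.

Section DampingRate.
Variable R : realType.
Variables sigma L delta : R.
Hypotheses (sigma0 : 0 < sigma) (L0 : 0 < L) (delta0 : 0 < delta).

Lemma normc_decay_lt1 x y : 0 < x -> normc (decay (x +i* y) L) < 1.
Proof. by move=> x0; rewrite normc_decay expR_lt1 oppr_lt0 mulr_gt0. Qed.

Lemma normc_reflection_lt1 x y : 0 < x -> 0 < y ->
  normc (reflection (x +i* y) delta) < 1.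
Proof.
move=> x0 y0; apply: le_lt_trans (normc_reflection_le _ x0 y0) _.
by rewrite expR_lt1 oppr_lt0 !mulr_gt0.
Qed.

Lemma schwarz_symbolE (x y : R) : 0 < x -> 0 < y ->
  let z := x +i* y in
  let a := schwarz_a 'i z L delta in let b := schwarz_b 'i z L delta in
  let e := decay z L in let h := reflection z delta in
  [/\ a != 0, b != 0, a + b = (e - h) / (1 - h * e) &
      a - b = (e + h) / (1 + h * e)].
Proof.
move=> x0 y0 z a b e h.
have e1 : normc e < 1 := normc_decay_lt1 y x0.
have h1 : normc h < 1 := normc_reflection_lt1 x0 y0.
have he1 := normc_mul_lt1 e1 h1.
have dB := one_sub_neq0 he1.
have dD : 1 + h * e != 0.
  by rewrite -[h * e]opprK; apply: one_sub_neq0; rewrite normc_opp.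
have d2 : 1 - (h * e) ^+ 2 != 0.
  have -> : 1 - (h * e) ^+ 2 = (1 - h * e) * (1 + h * e) by ring.
  by rewrite mulf_neq0.
have sq1 (w : R[i]) : normc w < 1 -> 1 - w ^+ 2 != 0.
  by move=> w1; apply: one_sub_neq0; rewrite expr2 normc_mul_lt1.
have pz : z + 'i != 0 by rewrite eq_complex /= addr0 (gt_eqF x0).
have qz : z - 'i != 0 by rewrite eq_complex /= oppr0 addr0 (gt_eqF x0).
have e0 : e != 0 by rewrite cexp_neq0.
have h0 : h != 0 by rewrite !mulf_neq0 ?invr_eq0 ?cexp_neq0.
have [aE bE] := schwarz_coefE pz d2; rewrite -/a -/b -/e -/h in aE bE.
split; rewrite ?aE ?bE ?oppr_eq0.
- by apply: mulf_neq0; [apply: mulf_neq0 => //; exact: sq1 | rewrite invr_eq0].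
- by apply: mulf_neq0; [apply: mulf_neq0 => //; exact: sq1 | rewrite invr_eq0].
- by field; rewrite dB d2.
- by field; rewrite dD d2.
Qed.

(** A lower bound of Re z valid for all s, see [attenuation_ge]. *)
Let x0 := Num.sqrt ((Num.sqrt (1 + sigma ^+ 2) - 1) / 2).

Lemma sqrt_sub1_gt0 : 0 < Num.sqrt (1 + sigma ^+ 2) - 1.
Proof.
rewrite subr_gt0 -[ltLHS]sqrtr1 ltr_sqrt; first by rewrite ltrDl exprn_gt0.
by rewrite ltr_pwDl // sqr_ge0.
Qed.

Lemma attenuation_gt0 : 0 < x0.
Proof. by rewrite sqrtr_gt0 divr_gt0 // sqrt_sub1_gt0. Qed.

Lemma attenuation_ge s x y : 0 < x -> 0 < y ->
  x ^+ 2 - y ^+ 2 = s ^+ 2 - 1 -> 2 * x * y = sigma -> x0 <= x.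
Proof.
move=> xp yp eu ev; rewrite -(ger0_norm (ltW xp)) -sqrtr_sqr.
by apply: ler_wsqrtr; apply: zeta_re_ge xp yp eu ev.
Qed.

Lemma damping_rate_bounded :
  exists C, forall s, damping_rate sigma L delta s <= C.
Proof.
have x0_gt0 := attenuation_gt0.
have f1 : 0 < 1 - expR (- (x0 * L)).
  by rewrite subr_gt0 expR_lt1 oppr_lt0 mulr_gt0.
exists (2 / (1 - expR (- (x0 * L)))) => s.
have [x [y [zE xp yp eu ev]]] := zeta_re_im s sigma0.
have [_ _ abD abB] := schwarz_symbolE xp yp.
have x0x := attenuation_ge xp yp eu ev.
rewrite /damping_rate zE /symbol_radius abD abB.
set e := decay _ _; set h := reflection _ _.
have e1 : normc e <= expR (- (x0 * L)).
  by rewrite normc_decay ler_expR lerN2 ler_pM2r.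
have h1 : normc h < 1 := normc_reflection_lt1 xp yp.
have he (w : R[i]) :
    normc w < 1 -> 1 - expR (- (x0 * L)) <= normc (1 - w * e).
  move=> w1; have := normcD (1 - w * e) (w * e).
  rewrite subrK ComplexField.Normc.normc1 ComplexField.Normc.normcM.
  have : normc w * normc e <= 1 * expR (- (x0 * L)).
    by apply: ler_pM; rewrite ?normc_ge0 // ltW.
  rewrite mul1r; lra.
have e2 : normc e < 1 := normc_decay_lt1 y xp.
have bound (w : R[i]) : normc w < 1 ->
    normc ((e - w) / (1 - w * e)) <= 2 / (1 - expR (- (x0 * L))).
  move=> w1; rewrite ComplexField.Normc.normcM ComplexField.Normc.normcV.
  have := he w w1 => hw; apply: ler_pM; rewrite ?normc_ge0 ?invr_ge0 ?normc_ge0 //.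
    by apply: le_trans (normcB _ _) _; lra.
  by rewrite lef_pV2 // posrE (lt_le_trans f1 hw).
rewrite ge_max bound //.
have -> : (e + h) / (1 + h * e) = (e - - h) / (1 - (- h) * e).
  by rewrite mulNr !opprK.
by rewrite bound // normc_opp.
Qed.

(** The second alternative bounds 4 |Im e| |Im h| by the decays of e and h
    alone; the constant is 2 x0^2 L delta. *)
Definition damping_threshold : Prop :=
  1 <= sigma \/ 1 < (Num.sqrt (1 + sigma ^+ 2) - 1) * L * delta.

Lemma im_product_le : damping_threshold ->
  exists2 theta, theta < 1 & forall s x y,
    0 < x -> 0 < y -> x ^+ 2 - y ^+ 2 = s ^+ 2 - 1 -> 2 * x * y = sigma ->
    4 * (`|complex.Im (decay (x +i* y) L)| *
         `|complex.Im (reflection (x +i* y) delta)|) <=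
    theta * ((1 - normc (decay (x +i* y) L) ^+ 2) *
             (1 - normc (reflection (x +i* y) delta) ^+ 2)).
Proof.
have x0_gt0 := attenuation_gt0.
case=> [sigma1|thr].
  exists (2 / (2 + (x0 * L / 2) ^+ 2)).
    rewrite ltr_pdivrMr; last by rewrite ltr_pwDl // sqr_ge0.
    by rewrite mul1r ltrDl exprn_gt0 // divr_gt0 // mulr_gt0.
  move=> s x y xp yp eu ev; set e := decay _ _; set h := reflection _ _.
  have x0x : 0 <= x0 <= x by rewrite (ltW x0_gt0) (attenuation_ge xp yp eu ev).
  (* |z|^2 = |z^2| >= Im (z^2) = sigma *)
  have M1 : 1 <= x ^+ 2 + y ^+ 2.
    have M0 : 0 <= x ^+ 2 + y ^+ 2 by rewrite addr_ge0 ?sqr_ge0.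
    rewrite -(@expr_ge1 _ 2) //.
    have -> : (x ^+ 2 + y ^+ 2) ^+ 2 = (x ^+ 2 - y ^+ 2) ^+ 2 + (2 * x * y) ^+ 2.
      by ring.
    rewrite ev; apply: (@le_trans _ _ (sigma ^+ 2)).
      by rewrite expr_ge1 // ltW.
    by rewrite lerDr sqr_ge0.
  have yx : y ^+ 2 - x ^+ 2 <= 1.
    by rewrite -opprB eu opprB lerBlDr lerDl sqr_ge0.
  have h1 := decay_im_le_sharp xp yp L0 x0x.
  have h2 := reflection_im_le_sharp xp yp delta0 yx M1.
  have := ler_pM _ _ h1 h2; rewrite -/e -/h.
  have -> : 2 * x * `|complex.Im e| * (2 * y * `|complex.Im h|) =
    x * y * (4 * (`|complex.Im e| * `|complex.Im h|)) by ring.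
  set t := 2 / _.
  have -> : t * y * (1 - normc e ^+ 2) * (x * (1 - normc h ^+ 2)) =
    x * y * (t * ((1 - normc e ^+ 2) * (1 - normc h ^+ 2))) by ring.
  by rewrite ler_pM2l ?mulr_gt0 //; apply; rewrite !mulr_ge0 // ltW.
exists ((Num.sqrt (1 + sigma ^+ 2) - 1) * L * delta)^-1.
  by rewrite invf_lt1 // (lt_trans _ thr).
move=> s x y xp yp eu ev; set e := decay _ _; set h := reflection _ _.
have K0 := lt_trans ltr01 thr.
have h1 := decay_im_le y xp L0.
have h2 := reflection_im_le xp yp delta0.
rewrite ler_pdivlMl //.
have := ler_pM _ _ h1 h2; rewrite -/e -/h => H; apply: le_trans (H _ _); last 2 first.
- by rewrite !mulr_ge0 // ltW.
- by rewrite !mulr_ge0 // ltW.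
have -> : 2 * `|complex.Im e| * (x * L) * (2 * `|complex.Im h| * (2 * x * delta)) =
  2 * x ^+ 2 * L * delta * (4 * (`|complex.Im e| * `|complex.Im h|)) by ring.
apply: ler_wpM2r; first by rewrite !mulr_ge0.
rewrite ler_pM2r // ler_pM2r // mulrC -ler_pdivrMr //.
exact: zeta_re_ge xp yp eu ev.
Qed.

(** As |e| and |h| are also bounded away from 1 uniformly in s, the contraction
    is uniform. *)
Lemma damping_rate_uniform : damping_threshold ->
  exists2 c, c < 1 & forall s, damping_rate sigma L delta s <= c.
Proof.
have x0_gt0 := attenuation_gt0.
move=> /im_product_le [theta t1 tP].
pose f1 := expR (- (x0 * L)); pose f2 := expR (- (2 * x0 * delta)).
pose c2 := 1 - (1 - theta) * ((1 - f1 ^+ 2) * (1 - f2 ^+ 2)) / 4.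
have f1_lt1 : f1 < 1 by rewrite expR_lt1 oppr_lt0 mulr_gt0.
have f2_lt1 : f2 < 1 by rewrite expR_lt1 oppr_lt0 !mulr_gt0.
exists (Num.sqrt c2) => [|s].
  rewrite -[ltRHS]sqrtr1 ltr_sqrt // ltrBlDr ltrDl divr_gt0 //.
  rewrite !mulr_gt0 ?subr_gt0 //.
    by rewrite expr_lt1 // expR_ge0.
  by rewrite expr_lt1 // expR_ge0.
have [x [y [zE xp yp eu ev]]] := zeta_re_im s sigma0.
have [_ _ abD abB] := schwarz_symbolE xp yp.
have x0x := attenuation_ge xp yp eu ev.
have := tP s x y xp yp eu ev.
rewrite /damping_rate zE /symbol_radius abD abB.
set e := decay _ _; set h := reflection _ _ => ehP.
have e1 : normc e < 1 := normc_decay_lt1 y xp.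
have h1 : normc h < 1 := normc_reflection_lt1 xp yp.
have ef : normc e <= f1 by rewrite normc_decay ler_expR lerN2 ler_pM2r.
have hf : normc h <= f2.
  apply: le_trans (normc_reflection_le _ xp yp) _.
  by rewrite ler_expR lerN2 ler_pM2r // ler_pM2l.
have bound (w : R[i]) : normc w = normc h -> `|complex.Im w| = `|complex.Im h| ->
    normc ((e - w) / (1 - w * e)) <= Num.sqrt c2.
  move=> nw iw; rewrite -[leLHS]ger0_norm ?normc_ge0 // -sqrtr_sqr.
  apply: ler_wsqrtr.
  apply: le_trans (mobius_contraction e1 _ (ltW t1) _) _; rewrite ?nw ?iw //.
  rewrite lerD2l lerN2 ler_pM2r ?invr_gt0 // ler_pM2l ?subr_gt0 //.
  apply: ler_pM; rewrite ?subr_ge0 ?expr_le1 ?expR_ge0 ?(ltW f1_lt1) ?(ltW f2_lt1) //.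
    by rewrite lerD2l lerN2 lerXn2r ?nnegrE ?normc_ge0 ?expR_ge0.
  by rewrite lerD2l lerN2 lerXn2r ?nnegrE ?normc_ge0 ?expR_ge0.
rewrite ge_max bound //.
have -> : (e + h) / (1 + h * e) = (e - - h) / (1 - (- h) * e).
  by rewrite mulNr !opprK.
by rewrite bound // ?normc_opp // raddfN normrN.
Qed.

End DampingRate.

(** * Continuity of the convergence factor *)

Section ComplexContinuity.
Variable R : realType.
Implicit Types (f g : R -> R[i]) (s : R).

(** Continuity in the product topology of the plane, as real and imaginary
    parts are what the explicit formulas involve. *)
Definition ccontinuous_at f s :=
  {for s, continuous (fun t => complex.Re (f t))} /\
  {for s, continuous (fun t => complex.Im (f t))}.

Lemma ccontinuous_cst (c : R[i]) s : ccontinuous_at (fun=> c) s.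
Proof. by split; apply: cvg_cst. Qed.

Lemma ccontinuousD f g s : ccontinuous_at f s -> ccontinuous_at g s ->
  ccontinuous_at (fun t => f t + g t) s.
Proof.
move=> [f1 f2] [g1 g2]; split.
  rewrite (_ : (fun _ => _) = fun t => complex.Re (f t) + complex.Re (g t)).
    exact: continuousD.
  by apply/funext => t; rewrite raddfD.
rewrite (_ : (fun _ => _) = fun t => complex.Im (f t) + complex.Im (g t)).
  exact: continuousD.
by apply/funext => t; rewrite raddfD.
Qed.

Lemma ccontinuousN f s : ccontinuous_at f s -> ccontinuous_at (fun t => - f t) s.
Proof.
move=> [f1 f2]; split.
  rewrite (_ : (fun _ => _) = fun t => - complex.Re (f t)).
    exact: continuousN.
  by apply/funext => t; rewrite raddfN.
rewrite (_ : (fun _ => _) = fun t => - complex.Im (f t)).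
  exact: continuousN.
by apply/funext => t; rewrite raddfN.
Qed.

Lemma ccontinuousB f g s : ccontinuous_at f s -> ccontinuous_at g s ->
  ccontinuous_at (fun t => f t - g t) s.
Proof. by move=> cf cg; apply: ccontinuousD => //; apply: ccontinuousN. Qed.

Lemma ccontinuousM f g s : ccontinuous_at f s -> ccontinuous_at g s ->
  ccontinuous_at (fun t => f t * g t) s.
Proof.
move=> [f1 f2] [g1 g2]; split.
  rewrite (_ : (fun _ => _) = fun t => complex.Re (f t) * complex.Re (g t) -
      complex.Im (f t) * complex.Im (g t)).
    by apply: continuousB; apply: continuousM.
  by apply/funext => t; case: (f t) (g t) => [? ?] [? ?].
rewrite (_ : (fun _ => _) = fun t => complex.Re (f t) * complex.Im (g t) +
    complex.Im (f t) * complex.Re (g t)).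
  by apply: continuousD; apply: continuousM.
by apply/funext => t; case: (f t) (g t) => [? ?] [? ?].
Qed.

Lemma ccontinuousV f s : f s != 0 -> ccontinuous_at f s ->
  ccontinuous_at (fun t => (f t)^-1) s.
Proof.
move=> fs0 [f1 f2].
pose n t := complex.Re (f t) ^+ 2 + complex.Im (f t) ^+ 2.
have n0 : n s != 0.
  rewrite /n; move: fs0; case: (f s) => a b.
  by rewrite -normc_gt0 => h; rewrite -normc_sqrE expf_neq0 // gt_eqF.
have cn : {for s, continuous (fun t => (n t)^-1)}.
  by apply: continuousV => //; apply: continuousD; apply: continuousM.
split.
  rewrite (_ : (fun _ => _) = fun t => complex.Re (f t) * (n t)^-1).
    exact: continuousM.
  by apply/funext => t; rewrite /n; case: (f t).
rewrite (_ : (fun _ => _) = fun t => (- complex.Im (f t)) * (n t)^-1).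
  by apply: continuousM => //; apply: continuousN.
by apply/funext => t; rewrite /n; case: (f t) => a b /=; rewrite mulNr.
Qed.

Lemma continuous_for_comp (f g : R -> R) s :
  {for s, continuous f} -> continuous g -> {for s, continuous (fun t => g (f t))}.
Proof. by move=> cf cg; apply: continuous_comp => //; apply: cg. Qed.

Lemma ccontinuous_cexp f s : ccontinuous_at f s ->
  ccontinuous_at (fun t => cexp (f t)) s.
Proof.
move=> [f1 f2]; split; rewrite /cexp /=; apply: continuousM;
  apply: continuous_for_comp => //.
- exact: continuous_expR.
- exact: continuous_cos.
- exact: continuous_expR.
- exact: continuous_sin.
Qed.

Lemma continuous_normc f s : ccontinuous_at f s ->
  {for s, continuous (fun t => normc (f t))}.
Proof.
move=> [f1 f2].
rewrite (_ : (fun _ => _) =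
    fun t => Num.sqrt (complex.Re (f t) ^+ 2 + complex.Im (f t) ^+ 2)).
  apply: continuous_for_comp; last exact: sqrt_continuous.
  by apply: continuousD; apply: continuousM.
by apply/funext => t; case: (f t).
Qed.

Lemma ccontinuous_zeta (sigma : R) s : 0 < sigma ->
  ccontinuous_at (fun t => zeta 1 sigma t) s.
Proof.
move=> sigma0.
have cu : {for s, continuous (fun t : R => t ^+ 2 - 1 ^+ 2)}.
  by apply: continuousB; [apply: continuousM; apply: cvg_id|apply: cvg_cst].
have cr : {for s, continuous (fun t : R =>
    Num.sqrt ((t ^+ 2 - 1 ^+ 2) ^+ 2 + (1 * sigma) ^+ 2))}.
  apply: continuous_for_comp; last exact: sqrt_continuous.
  by apply: continuousD; [apply: continuousM|apply: cvg_cst].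
rewrite /zeta /sqrtc; split => /=.
  apply: continuous_for_comp; last exact: sqrt_continuous.
  by apply: continuousM; [apply: continuousD|apply: cvg_cst].
apply: continuousM; first exact: cvg_cst.
apply: continuous_for_comp; last exact: sqrt_continuous.
by apply: continuousM; [apply: continuousB|apply: cvg_cst].
Qed.

Lemma damping_rate_continuous (sigma L delta : R) : 0 < sigma -> 0 < L -> 0 < delta ->
  continuous (damping_rate sigma L delta).
Proof.
move=> sigma0 L0 delta0 s.
pose e (t : R) := decay (zeta 1 sigma t) L.
pose h (t : R) := reflection (zeta 1 sigma t) delta.
have symb (t : R) : exists x y : R, [/\ zeta 1 sigma t = x +i* y, 0 < x & 0 < y].
  by have [x [y [? ? ? _ _]]] := zeta_re_im t sigma0; exists x, y.
have rateE : damping_rate sigma L delta = (fun t : R =>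
    normc ((e t - h t) / (1 - h t * e t))) \max
    (fun t : R => normc ((e t + h t) / (1 + h t * e t))).
  apply/funext => t; have [x [y [zE x0 y0]]] := symb t.
  rewrite /Order.max_fun /damping_rate /symbol_radius /e /h zE.
  by have [_ _ -> ->] := schwarz_symbolE L0 delta0 x0 y0.
have cz := ccontinuous_zeta s sigma0.
have ce : ccontinuous_at e s.
  apply: ccontinuous_cexp; apply: ccontinuousN; apply: ccontinuousM => //.
  exact: ccontinuous_cst.
have [x [y [zE x0 y0]]] := symb s.
have pz : zeta 1 sigma s + 'i != 0 by rewrite zE eq_complex /= addr0 (gt_eqF x0).
have ch : ccontinuous_at h s.
  apply: ccontinuousM.
    apply: ccontinuousM.
      by apply: ccontinuousB => //; apply: ccontinuous_cst.
    by apply: ccontinuousV => //; apply: ccontinuousD => //; apply: ccontinuous_cst.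
  apply: ccontinuous_cexp; apply: ccontinuousN; apply: ccontinuousM.
    by apply: ccontinuousM => //; apply: ccontinuous_cst.
  exact: ccontinuous_cst.
have che : ccontinuous_at (fun t => h t * e t) s by apply: ccontinuousM.
have he1 : normc (h s * e s) < 1.
  rewrite /h /e zE; apply: normc_mul_lt1; first exact: normc_decay_lt1.
  exact: normc_reflection_lt1.
rewrite rateE; apply: continuous_max; apply: continuous_normc; apply: ccontinuousM.
- exact: ccontinuousB.
- apply: ccontinuousV; first exact: one_sub_neq0.
  by apply: ccontinuousB => //; apply: ccontinuous_cst.
- exact: ccontinuousD.
- apply: ccontinuousV; last by apply: ccontinuousD => //; apply: ccontinuous_cst.
  by rewrite -[h s * e s]opprK; apply: one_sub_neq0; rewrite normc_opp.
Qed.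

End ComplexContinuity.

(** * Suprema over the Fourier numbers *)

Section Helmholtz.
Variable R : realType.
Implicit Types (k sigma L delta s Lhat : R).

Lemma spectral_radius_T1d_le k sigma L delta s N :
  0 < k -> 0 < sigma ->
  spectral_radius (T1d (0 +i* k) k (sigma * k) (L / k) (delta / k) s N) <=
  damping_rate sigma L delta (s / k).
Proof.
by move=> k0 sigma0; rewrite T1d_scale //; apply: spectral_radius_toeplitz_le.
Qed.

Lemma spectral_radius_T1d_cvg k sigma L delta s :
  0 < k -> 0 < sigma -> 0 < L -> 0 < delta ->
  (fun N => spectral_radius
     (T1d (0 +i* k) k (sigma * k) (L / k) (delta / k) s N)) @ \oo -->
  damping_rate sigma L delta (s / k).
Proof.
move=> k0 sigma0 L0 delta0.
rewrite -cvg_shiftS; under eq_fun do rewrite T1d_scale //.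
apply: spectral_radius_toeplitz_cvg.
all: have [x [y [-> x0 y0 _ _]]] := zeta_re_im (s / k) sigma0.
all: by have [? ? _ _] := schwarz_symbolE L0 delta0 x0 y0.
Qed.

Lemma R1dE k sigma L delta s : 0 < k -> 0 < sigma -> 0 < L -> 0 < delta ->
  R1d (0 +i* k) k (sigma * k) (L / k) (delta / k) s =
  damping_rate sigma L delta (s / k).
Proof.
by move=> k0 sigma0 L0 delta0; apply/cvg_lim => //; apply: spectral_radius_T1d_cvg.
Qed.

Lemma jointly_large_damping_threshold : jointly_large (@damping_threshold R).
Proof.
have g0 s : 0 < s -> 0 < Num.sqrt (1 + s ^+ 2) - 1 by apply: sqrt_sub1_gt0.
split.
- move=> s L d s' L' d' s0 L0 d0 ss LL dd [s1|P]; first by left; apply: le_trans ss.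
  right; apply: lt_le_trans P _.
  apply: ler_pM; rewrite ?mulr_ge0 ?(ltW (g0 _ s0)) ?(ltW L0) ?(ltW d0) //.
  apply: ler_pM; rewrite ?(ltW (g0 _ s0)) ?(ltW L0) //.
  rewrite lerD2r ler_wsqrtr // lerD2l lerXn2r // nnegrE ltW //.
  exact: lt_le_trans ss.
- by move=> L d _ _; exists 1 => //; left.
- move=> s d s0 d0.
  have D0 : 0 < (Num.sqrt (1 + s ^+ 2) - 1) * d by rewrite mulr_gt0 ?g0.
  exists (2 / ((Num.sqrt (1 + s ^+ 2) - 1) * d)); first by rewrite divr_gt0.
  by right; rewrite mulrAC mulrCA mulfV ?gt_eqF // mulr1 ltr1n.
- move=> s L s0 L0.
  have D0 : 0 < (Num.sqrt (1 + s ^+ 2) - 1) * L by rewrite mulr_gt0 ?g0.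
  exists (2 / ((Num.sqrt (1 + s ^+ 2) - 1) * L)); first by rewrite divr_gt0.
  by right; rewrite mulrCA mulfV ?gt_eqF // mulr1 ltr1n.
Qed.

(** The scaled Fourier numbers form a grid of step pi / (Lhat k), which tends
    to 0 as k grows. *)
Lemma fourier_number_dense Lhat s d : 0 < Lhat -> 0 < s -> 0 < d ->
  \forall k \near +oo, 0 < k -> exists2 m, (0 < m)%N &
    `|fourier_number Lhat m / k - s| < d.
Proof.
move=> Lhat0 s0 d0; near=> k => k0.
pose h := pi / Lhat / k.
have h0 : 0 < h by rewrite !divr_gt0 ?pi_gt0.
have hd : h < d.
  rewrite /h ltr_pdivrMr // [ltRHS]mulrC -ltr_pdivrMr //.
  by near: k; apply: nbhs_pinfty_gt; rewrite num_real.
exists (Num.trunc (s / h)).+1 => //.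
have -> : fourier_number Lhat (Num.trunc (s / h)).+1 / k =
    (Num.trunc (s / h)).+1%:R * h.
  by rewrite /fourier_number /h !mulrA.
have /andP[l1 l2] := truncn_itv (ltW (divr_gt0 s0 h0)).
rewrite ler_pdivlMr // in l1; rewrite ltr_pdivrMr // in l2.
rewrite ger0_norm ?subr_ge0 ?(ltW l2) //.
rewrite ltrBlDr -natr1 mulrDl mul1r addrC.
by apply: ltr_leD.
Unshelve. all: by end_near. Qed.

End Helmholtz.

Theorem corollary4p2 (R : realType) :
  exists suff_large : R -> R -> R -> Prop,
  [/\ jointly_large suff_large,
      forall sigma0 L0 delta0 : R,
        1 <= sigma0 -> 0 < L0 -> 0 < delta0 -> suff_large sigma0 L0 delta0
    & forall Lhat sigma0 L0 delta0 : R,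
        0 < Lhat -> 0 < sigma0 -> 0 < L0 -> 0 < delta0 ->
        let T (k : R) (m N : nat) :=
          T1d (0 +i* k) k (sigma0 * k) (L0 / k) (delta0 / k)
            (fourier_number Lhat m) N in
        let R2 (k : R) :=
          R2d (0 +i* k) k (sigma0 * k) (L0 / k) (delta0 / k) Lhat in
        (forall (k : R) (m : nat), 0 < k -> (0 < m)%N ->
           cvgn (fun N => spectral_radius (T k m N))) /\
        exists Rbar : R,
          [/\ forall k : R, 0 < k -> (R2 k <= Rbar%:E)%E,
              R2 k @[k --> +oo] --> Rbar%:E
            & suff_large sigma0 L0 delta0 ->
                Rbar < 1 /\
                \forall k \near +oo, forall N m : nat,
                  (1 < N)%N -> (0 < m)%N ->
                  spectral_radius (T k m N) <= Rbar]].
Proof.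
exists (@damping_threshold R); split.
- exact: jointly_large_damping_threshold.
- by move=> s L d s1 _ _; left.
move=> Lhat sigma L delta Lhat0 sigma0 L0 delta0 T R2; split.
  move=> k m k0 m0; apply: cvgP.
  exact: (spectral_radius_T1d_cvg k0 sigma0 L0 delta0).
pose rate := damping_rate sigma L delta.
pose E := [set rate s | s in [set s : R | 0 < s]].
have [C rateC] := damping_rate_bounded sigma0 L0 delta0.
have Esup : has_sup E.
  split; first by exists (rate 1); exists 1 => //=.
  by exists C => _ [s _ <-].
have rate_le s : 0 < s -> rate s <= sup E.
  by move=> s0; apply: ub_le_sup; [case: Esup|exists s].
have fourier_gt0 k m : 0 < k -> (0 < m)%N -> 0 < fourier_number Lhat m / k.
  by move=> k0 m0; rewrite !divr_gt0 ?mulr_gt0 ?pi_gt0 ?ltr0n.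
have R2_le k : 0 < k -> (R2 k <= (sup E)%:E)%E.
  move=> k0; apply: ge_ereal_sup => _ [m /= m0 <-].
  by rewrite R1dE // lee_fin rate_le // fourier_gt0.
have R2_ge k m : 0 < k -> (0 < m)%N ->
    ((rate (fourier_number Lhat m / k))%:E <= R2 k)%E.
  by move=> k0 m0; apply: ereal_sup_ubound; exists m => //; rewrite R1dE.
exists (sup E); split=> //.
- apply/fine_cvgP; split.
    near=> k; have k0 : 0 < k by near: k; apply: nbhs_pinfty_gt; rewrite num_real.
    rewrite fin_numE; apply/andP; split.
      by rewrite -ltNye (lt_le_trans (ltNyr _) (R2_ge k 1%N k0 _)).
    by rewrite -ltey (le_lt_trans (R2_le k k0)) ?ltry.
  apply/cvgrPdist_lt => eps eps0.
  have [_ [s s0 <-] sE] := sup_adherent eps0 Esup.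
  (* A grid point close to a near-maximizer s gives the lower bound. *)
  have gap : 0 < rate s - (sup E - eps) by rewrite subr_gt0.
  have /cvgrPdist_lt/(_ _ gap)/nbhs_ballP[d /= d0 near_s] :=
    damping_rate_continuous sigma0 L0 delta0 (x := s).
  near=> k; have k0 : 0 < k by near: k; apply: nbhs_pinfty_gt; rewrite num_real.
  have [m m0 ms] : exists2 m, (0 < m)%N & `|fourier_number Lhat m / k - s| < d.
    by move: k0; near: k; apply: fourier_number_dense.
  have := near_s (fourier_number Lhat m / k); rewrite /ball /= distrC => /(_ ms).
  have := R2_le k k0; have := R2_ge k m k0 m0.
  case: (R2 k) => [r||] //=; rewrite !lee_fin => r1 r2 /ltr_normlW.
  rewrite -/rate => rs.
  by rewrite ger0_norm ?subr_ge0 //; lra.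
- move=> /(damping_rate_uniform sigma0 L0 delta0) [c c1 cP]; split.
    apply: le_lt_trans c1; apply: ge_sup; first by case: Esup.
    by move=> _ [s _ <-].
  near=> k => N m _ m0.
  have k0 : 0 < k by near: k; apply: nbhs_pinfty_gt; rewrite num_real.
  apply: le_trans (spectral_radius_T1d_le _ _ _ _ k0 sigma0) _.
  by rewrite rate_le // fourier_gt0.
Unshelve. all: by end_near. Qed.
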